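(* Let $\kappa\ge1$ be an integer (the known maximum job length). Among all $\chi>1$, the greedy mechanism $\Gamma_G$ with exponential priority function $f(\delta)=\chi^\delta$ obtains its best (smallest) competitive ratio when $\chi=\left(\frac{\kappa+1}{\kappa}\right)^{\kappa}$. Moreover, for this $\chi$: (i) for every integer $h\ge2$, on the class of all instances with capacity $C\ge h\cdot n_{\max}$ (where $n_{\max}$ is the maximum number of instances demanded by a job) and job lengths in $[1,\kappa]$, the competitive ratio is $\frac{h}{h-1}\cdot(\kappa+1)\left(1+\frac1\kappa\right)^{\kappa}+1$; (ii) on the class of all instances with $C=n_{\max}=1$ and job lengths in $[1,\kappa]$, the competitive ratio is $(\kappa+1)\left(1+\frac1\kappa\right)^{\kappa}+1$. (The optimality of $\chi=\left(\frac{\kappa+1}{\kappa}\right)^{\kappa}$ holds on each of the classes in (i) and (ii).)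
   Context: Setting. A cloud provider has $C\in\mathbb{N}$ identical instances at every time $t\in[0,\infty)$. A job sequence $\theta$ is a finite list of jobs $\theta_i=(r_i,d_i,n_i,l_i,v_i)$: release time $r_i\ge0$, deadline $d_i$, required number of instances $n_i$ (positive integer, $n_i\le n_{\max}\le C$), length $l_i\in[1,\kappa]$ ($\kappa$ a positive integer), value $v_i>0$. Nothing is known about job $i$ before time $r_i$. An allocation is feasible if at every time the total number of allocated instances is at most $C$. Job $i$ is completed if it receives at least $n_i$ instances continuously for $l_i$ time units between $r_i$ and $d_i$; an interrupted job loses all its progress but may be restarted from scratch. The social welfare of an allocation is the sum of the values of the completed jobs. $OPT(\theta)$ is the maximum social welfare of a feasible allocation computed offline with full knowledge of $\theta$; $W(M,\theta)$ is the social welfare obtained by the online mechanism $M$ on $\theta$ (with truthful reports). Competitiveness. $M$ is $c$-competitive on a class of instances if no instance in the class satisfies $c\cdot W(M,\theta)<OPT(\theta)$. The competitive ratio of $M$ on the class is the least such $c$ ($\infty$ if there is none). Mechanism $\Gamma_G$ with priority function $f$ ($f:[0,1]\to\mathbb{R}$ non-decreasing, $f(0)=1$). At time $t$ let $\delta_i\in[0,1]$ be the fraction of $l_i$ for which job $i$ has been continuously processed up to $t$ in its current uninterrupted run ($\delta_i=0$ if it is not running). Job $i$ is feasible at $t$ if $r_i\le t$, $d_i-t\ge(1-\delta_i)l_i$, and it has not been completed. A time is critical if a job is released or a running job is completed at that time. At every critical time $t$, in increasing order: let $J_F$ be the set of feasible jobs; set $v_i'=v_if(\delta_i)$ and $\rho_i'=\frac{v_i}{n_i}f(\delta_i)$;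 number the jobs of $J_F$ by descending $\rho_i'$ (ties broken by an arbitrary fixed rule). If the total demand $\sum n_i$ of all jobs in $J_F$ is at most $C$, run all of $J_F$. Otherwise let $k$ be the smallest index with $n_1+\dots+n_k>C$; if $\sum_{i=1}^{k-1}v_i'\ge v_k'$ run jobs $1,\dots,k-1$, else run only job $k$. The chosen jobs run (job $i$ on $n_i$ instances) until the next critical time; running jobs that are not chosen are interrupted. (Each completed job pays its critical value, the minimum reported value for which it would be completed; payments do not affect social welfare.) *)

(* Defs.v *)
From mathcomp Require Import all_boot all_order all_algebra.
From mathcomp Require Import all_classical all_reals all_analysis.
Set Implicit Arguments.
Unset Strict Implicit.
Unset Printing Implicit Defensive.
Import Order.TTheory GRing.Theory Num.Theory.
Local Open Scope classical_set_scope.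
Local Open Scope ring_scope.

Record job (R : realType) := Job {
  release : R;
  deadline : R;
  demand : nat;
  len : R;
  value : R }.

Definition valid_job (R : realType) (kappa : nat) (j : job R) : Prop :=
  [/\ 0 <= release j, (0 < demand j)%N, 1 <= len j <= kappa%:R
    & 0 < value j].

Definition nmax (R : realType) (n : nat) (theta : n.-tuple (job R)) : nat :=
  \max_(i < n) demand (tnth theta i).

(* [a i t] is the number of instances given to job [i] at time [t]. *)
Definition allocation (R : realType) (n : nat) := 'I_n -> R -> nat.

Definition feasible (R : realType) (C n : nat) (a : allocation R n) : Prop :=
  forall t : R, 0 <= t -> (\sum_(i < n) a i t <= C)%N.

(* Runs occupy half-open time intervals, so that a job may start at the very
   instant at which another one ends. *)
Definition completed (R : realType) (n : nat) (theta : n.-tuple (job R))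
    (a : allocation R n) (i : 'I_n) : Prop :=
  exists s : R,
    [/\ release (tnth theta i) <= s,
        s + len (tnth theta i) <= deadline (tnth theta i)
      & forall t : R, s <= t < s + len (tnth theta i) ->
          (demand (tnth theta i) <= a i t)%N].

Definition welfare (R : realType) (n : nat) (theta : n.-tuple (job R))
    (a : allocation R n) : R :=
  \sum_(i < n | `[< completed theta a i >]) value (tnth theta i).

(* The supremum is a maximum: welfares are sums over subsets of ['I_n];
   see [OPT_max]. *)
Definition OPT (R : realType) (C n : nat) (theta : n.-tuple (job R)) : R :=
  sup [set welfare theta a | a in [set a | @feasible R C n a]].

(* What a tie-breaking rule may look at: position of the job in the sequence,
   the job itself, and its current fraction delta. *)
Definition candidate (R : realType) : Type := (nat * job R * R)%type.

(* [start i = Some s] when job [i] is running and its current uninterrupted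
   run began at time [s]; [None] when it is not running. *)
Record state (R : realType) (n : nat) := State {
  now : R;
  start : 'I_n -> option R;
  finished : {set 'I_n} }.

Definition fraction (R : realType) (n : nat) (theta : n.-tuple (job R))
    (st : state R n) (t : R) (i : 'I_n) : R :=
  if start st i is Some s then (t - s) / len (tnth theta i) else 0.

Definition total_demand (R : realType) (n : nat) (theta : n.-tuple (job R))
    (s : seq 'I_n) : nat :=
  (\sum_(i <- s) demand (tnth theta i))%N.

(* With 0-based positions, [p] is the position of the job numbered k in the
   mechanism, so [take p s] is 1, ..., k-1.  [s] is the list of feasible jobs
   by descending priority density, [vp] the priority values v'. *)
Definition greedy_choice (R : realType) (C n : nat) (theta : n.-tuple (job R))
    (vp : 'I_n -> R) (s : seq 'I_n) : seq 'I_n :=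
  if (total_demand theta s <= C)%N then s else
  let p := find (fun m => (C < total_demand theta (take m.+1 s))%N)
                (iota 0 (size s)) in
  if drop p s is k :: _ then
    if vp k <= \sum_(i <- take p s) vp i then take p s else [:: k]
  else [::].

(* One round of the mechanism Gamma_G with priority function [f].
   [start st] and [finished st] describe the situation just before [t], where
   [t] is the first critical time after [now st]. *)
Definition decide (R : realType) (f : R -> R) (tie : rel (candidate R))
    (C n : nat) (theta : n.-tuple (job R)) (st : state R n) (t : R) :
    state R n :=
  let fin := (finished st :|:
    [set i | if start st i is Some s then s + len (tnth theta i) <= t
             else false])%SET in
  let delta := fraction theta st t in
  let JF := [seq i <- enum 'I_n |
    [&& release (tnth theta i) <= t,
        (1 - delta i) * len (tnth theta i) <= deadline (tnth theta i) - t
      & i \notin fin]] in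
  let vp i := value (tnth theta i) * f (delta i) in
  let rhop i := value (tnth theta i) / (demand (tnth theta i))%:R
                * f (delta i) in
  let cand i := (nat_of_ord i, tnth theta i, delta i) in
  let before i j :=
    (rhop j < rhop i) || ((rhop i == rhop j) && tie (cand i) (cand j)) in
  let chosen := greedy_choice C theta vp (sort before JF) in
  State t
    (fun i => if i \in chosen
              then Some (if start st i is Some s then s else t) else None)
    fin.

Definition next_critical (R : realType) (n : nat) (theta : n.-tuple (job R))
    (st : state R n) : option R :=
  let times := [seq t <- [seq release (tnth theta i) | i <- enum 'I_n] ++
    pmap (fun i => omap (fun s => s + len (tnth theta i)) (start st i))
         (enum 'I_n) | now st < t] in
  if times is t0 :: ts then Some (foldr Num.min t0 ts) else None.

Definition gstep (R : realType) (f : R -> R) (tie : rel (candidate R))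
    (C n : nat) (theta : n.-tuple (job R)) (st : state R n) : state R n :=
  if next_critical theta st is Some t then decide f tie C theta st t else st.

(* Release times are nonnegative, so -1 precedes every critical time. *)
Definition init_state (R : realType) (n : nat) : state R n :=
  State (-1) (fun=> None) finset.set0.

(* There are at most [n] release times and [n] completions, hence [n + n]
   steps exhaust all critical times; see [next_critical_final]. *)
Definition final_state (R : realType) (f : R -> R) (tie : rel (candidate R))
    (C n : nat) (theta : n.-tuple (job R)) : state R n :=
  iter (n + n) (gstep f tie C theta) (init_state R n).

Definition greedy_welfare (R : realType) (f : R -> R)
    (tie : rel (candidate R)) (C n : nat) (theta : n.-tuple (job R)) : R :=
  \sum_(i in finished (final_state f tie C theta)) value (tnth theta i).

Definition mech_welfare (R : realType) : Type :=
  nat -> forall n : nat, n.-tuple (job R) -> R.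

Definition instance_class (R : realType) : Type :=
  nat -> forall n : nat, n.-tuple (job R) -> Prop.

Definition competitive (R : realType) (K : instance_class R)
    (W : mech_welfare R) (c : R) : Prop :=
  ~ exists (C n : nat) (theta : n.-tuple (job R)),
      K C n theta /\ c * W C n theta < OPT C theta.

(* The infimum is a minimum whenever it is finite; see
   [competitive_ratio_attained]. *)
Definition competitive_ratio (R : realType) (K : instance_class R)
    (W : mech_welfare R) : \bar R :=
  ereal_inf [set c%:E | c in competitive K W].

(* For [0 < h] the second condition also gives [nmax theta <= C]. *)
Definition capacity_class (R : realType) (kappa h : nat) : instance_class R :=
  fun C n theta => (forall i : 'I_n, valid_job kappa (tnth theta i)) /\
    (h * nmax theta <= C)%N.

Definition unit_class (R : realType) (kappa : nat) : instance_class R :=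
  fun C n theta => (forall i : 'I_n, valid_job kappa (tnth theta i)) /\
    C = 1%N /\ nmax theta = 1%N.

Lemma OPT_max (R : realType) (C n : nat) (theta : n.-tuple (job R)) :
  exists2 a, @feasible R C n a & OPT C theta = welfare theta a.
Proof.
pose ok (S : {set 'I_n}) := `[< exists2 a, @feasible R C n a &
  S = [set i | `[< completed theta a i >]]%SET >].
pose w (S : {set 'I_n}) := \sum_(i in S) value (tnth theta i).
have wE a : welfare theta a = w [set i | `[< completed theta a i >]]%SET.
  by apply: eq_bigl => i; rewrite inE.
pose a0 : allocation R n := fun _ _ => 0%N.
have fa0 : feasible C a0 by move=> t _; rewrite big1.
have ok0 : ok [set i | `[< completed theta a0 i >]]%SET.
  by apply/asboolP; exists a0.
case: (Order.TotalTheory.arg_maxP w ok0) => S /asboolP[a fa SE] Smax.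
exists a => //; rewrite wE -SE; apply/eqP; rewrite eq_le; apply/andP; split.
  apply: ge_sup => [|_ [b fb <-]]; first by exists (welfare theta a0); exists a0.
  by rewrite wE; apply: Smax; apply/asboolP; exists b.
apply: ub_le_sup; last by exists a; rewrite // wE -SE.
exists (w S) => _ [b fb <-]; rewrite wE; apply: Smax.
by apply/asboolP; exists b.
Qed.

Lemma competitive_ratio_attained (R : realType) (K : instance_class R)
    (W : mech_welfare R) (c : R) :
  competitive_ratio K W = c%:E ->
  competitive K W c /\ (forall c', competitive K W c' -> c <= c').
Proof.
move=> cE; split; last first.
  by move=> c' c'P; rewrite -lee_fin -cE; apply: ereal_inf_lbound; exists c'.
move=> [C [n [theta [Kth lt_opt]]]].
have near_c e : 0 < e -> exists2 c', competitive K W c' & c <= c' < c + e.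
  move=> e0; have : (competitive_ratio K W < (c + e)%:E)%E.
    by rewrite cE lte_fin ltrDl.
  move=> /ereal_inf_lt[_ [c' c'P <-]]; rewrite lte_fin => lt_c'.
  exists c' => //; rewrite lt_c' andbT -lee_fin -cE.
  by apply: ereal_inf_lbound; exists c'.
set o := OPT C theta in lt_opt; set w := W C n theta in lt_opt.
have e0 : 0 < (o - c * w) / (`|w| + 1).
  by rewrite divr_gt0 ?subr_gt0 // ltr_wpDl.
have [c' c'P /andP[le_c lt_c']] := near_c _ e0.
apply: c'P; exists C, n, theta; split => //; rewrite -/o -/w.
have : (c' - c) * w <= (c' - c) * `|w|.
  by rewrite ler_wpM2l ?ler_norm // subr_ge0.
have : (c' - c) * `|w| < o - c * w.
  have : (c' - c) * (`|w| + 1) < o - c * w.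
    by rewrite -ltr_pdivlMr ?ltr_wpDl // ltrBlDl.
  apply: le_lt_trans; rewrite ler_wpM2l ?subr_ge0 //.
  by rewrite lerDl.
move=> h1 h2; have := le_lt_trans h2 h1.
by rewrite mulrBl ltrD2r.
Qed.

Section Termination.
Context (R : realType) (f : R -> R) (tie : rel (candidate R)) (C n : nat).
Context (theta : n.-tuple (job R)).

Let pending (st : state R n) : nat :=
  (#|[set i : 'I_n | (now st < release (tnth theta i))%R]%SET|
   + #|~: finished st|)%N.

Let wf (st : state R n) : Prop :=
  forall i, start st i != None -> i \notin finished st.

Lemma next_criticalP (st : state R n) (t : R) :
  next_critical theta st = Some t ->
  now st < t /\ ((exists i, release (tnth theta i) = t) \/
    (exists i s, start st i = Some s /\ s + len (tnth theta i) = t)).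
Proof.
rewrite /next_critical; set times := [seq _ <- _ | _] => nE.
have : t \in times.
  move: nE; case: times => //= t0 ts [<-].
  elim: ts => [|t1 ts IH] /=; first by rewrite inE.
  rewrite minEle; case: ifP => _; first by rewrite !inE eqxx orbT.
  by move: IH; rewrite !inE => /orP[->//|->]; rewrite !orbT.
rewrite mem_filter mem_cat => /andP[lt_t tin]; split=> //; move: tin.
move=> /orP[/mapP[i _ ->]|]; first by left; exists i.
rewrite mem_pmap => /mapP[i _]; case E: (start st i) => [s|] //= [tE].
by right; exists i, s.
Qed.

Lemma pending_step (st : state R n) : wf st ->
  wf (gstep f tie C theta st) /\
  (next_critical theta st != None ->
   (pending (gstep f tie C theta st) < pending st)%N).
Proof.
move=> wfst; rewrite /gstep.
case E: (next_critical theta st) => [t|] //.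
have [lt_t crit] := next_criticalP E.
split=> [i|_].
  rewrite /decide /=; case: ifP => // ich _; move: ich.
  rewrite /greedy_choice; set s := sort _ _.
  have sP : {subset s <= [predC finished st :|: [set i | if start st i is Some s
    then s + len (tnth theta i) <= t else false]]%SET}.
    by move=> j; rewrite mem_sort mem_filter => /andP[/and3P[_ _]].
  case: ifP => _; first exact: sP.
  set p := seq.find _ _; case D: (drop p s) => [//|k s'].
  have ks : k \in s by rewrite -[s](cat_take_drop p) mem_cat D mem_head orbT.
  case: ifP => _; first by move/mem_take; apply: sP.
  by rewrite inE => /eqP ->; apply: sP.
rewrite /pending /=.
have sub1 : [set i | (t < release (tnth theta i))%R]%SET
    \subset [set i | (now st < release (tnth theta i))%R]%SET.
  by apply/fintype.subsetP => i; rewrite !inE; apply: lt_trans.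
set fin := finset.setU _ _.
have sub2 : ~: fin \subset ~: finished st.
  by rewrite finset.setCS; apply: finset.subsetUl.
case: crit => [[i ri]|[i [s [si st_t]]]].
- rewrite -addSn leq_add ?subset_leq_card //; apply: proper_card.
  rewrite properE sub1; apply/negP => /fintype.subsetP/(_ i).
  by rewrite !inE ri ltxx lt_t => /(_ isT).
- rewrite -addnS leq_add ?subset_leq_card //; apply: proper_card.
  rewrite properE sub2; apply/negP => /fintype.subsetP/(_ i).
  have := wfst i; rewrite !inE si => /(_ isT) ->.
  by rewrite st_t lexx orbT => /(_ isT).
Qed.

Lemma next_critical_final :
  next_critical theta (final_state f tie C theta) = None.
Proof.
rewrite /final_state.
have wf0 : wf (init_state R n) by [].
have : next_critical theta (init_state R n) = None \/
    (pending (init_state R n) <= n + n)%N.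
  by right; rewrite leq_add // -[leqRHS]card_ord max_card.
elim: (n + n)%N (init_state R n) wf0 => [|m IH] st wfst.
  case=> // le_m; have [_ lt_m] := pending_step wfst.
  apply/eqP; apply: contraTT le_m => /lt_m lt0.
  by rewrite -ltnNge; apply: leq_ltn_trans lt0.
have [wf' lt_m] := pending_step wfst.
move=> le_m; rewrite iterSr; apply: IH => //.
have [eN|ne] := eqVneq (next_critical theta st) None.
  by left; rewrite /gstep eN.
right; case: le_m => [eN|le_m]; first by rewrite eN in ne.
by rewrite -ltnS; apply: leq_trans (lt_m ne) le_m.
Qed.
End Termination.

(* Main.v *)
(* Write [Y t = chi `^ (t / kappa)] and [y = Y 1]; the priority of a running job
   grows by a factor at least [y] per unit of time, and by [chi] over its run.
   For every [chi > 1] the ratio is [C / (C - nmax + 1)], whose supremum over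
   the class is [h / (h - 1)] (resp. [1]), times [chi * y / (y - 1)], plus [1];
   [chi * y / (y - 1) = y ^ (kappa + 1) / (y - 1)] is least at
   [y = (kappa + 1) / kappa].

   Upper bound.  When [2 nmax <= C + 1] the mechanism always runs a prefix of
   the feasible jobs by density, of total demand at least [u = C - nmax + 1] if
   some feasible job is left out.  Let the optimum start at time [t0] a job of
   density [rho] that the mechanism never completes.  From then on, or from the
   moment the mechanism drops that job, running jobs of priority density at
   least [rho * Y (t - t0)], together with those completed above this
   threshold, have total demand at least [u]: replacing one of them requires
   [u] units of demand of higher priority.  In the end all of them are
   completed, so [u * rho] is at most the sum of [chi * v_j * Y (t0 - e_j)] over
   the jobs [j] completed at times [e_j > t0].  Summing over the jobs of the
   optimum, a completed [j] is charged for demand at most [C] in each unit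
   window before [e_j], which gives the geometric series [y / (y - 1)].

   Lower bound.  A chain of long jobs, each released just in time to interrupt
   the previous one, makes the running density follow [Y t] up to an arbitrarily
   small factor until its end [e].  They leave less than [n = nmax] instances
   free, while the optimum fills the whole capacity with unit-length jobs of
   demand [n] and density just below [Y t], started at [e - eps - k] for
   [k = 0, 1, 2, ...], and runs the last long jobs afterwards. *)
Require Import Defs.
From mathcomp Require Import all_boot all_order all_algebra.
From mathcomp Require Import all_classical all_reals all_analysis.
From mathcomp Require Import ring lra zify.
Set Implicit Arguments.
Unset Strict Implicit.
Unset Printing Implicit Defensive.
Import Order.TTheory GRing.Theory Num.Theory.
Import numFieldNormedType.Exports.
Local Open Scope ring_scope.

(** * The greedy choice *)

Section GreedyChoice.
Context (R : realType) (C n : nat) (theta : n.-tuple (job R)).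
Let dem i := demand (tnth theta i).

Lemma demand_le_nmax i : (dem i <= nmax theta)%N.
Proof. exact: (leq_bigmax_cond (F := fun i => demand (tnth theta i))). Qed.

Lemma total_demand_cat s1 s2 :
  total_demand theta (s1 ++ s2) =
  (total_demand theta s1 + total_demand theta s2)%N.
Proof. by rewrite /total_demand big_cat. Qed.

(* When [2 * nmax <= C + 1] the jobs ranked before the first one that does not
   fit demand at least as much as it does, at no smaller densities, so the
   single-job branch of the mechanism is never taken. *)
Lemma greedy_choice_prefix (rho vp : 'I_n -> R) s :
  (2 * nmax theta <= C.+1)%N -> (forall i, 0 <= rho i) ->
  (forall i, vp i = (dem i)%:R * rho i) ->
  sorted (fun i j => rho j <= rho i) s ->
  exists p, [/\ greedy_choice C theta vp s = take p s,
    (total_demand theta (take p s) <= C)%N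
    & (p < size s)%N -> (C < total_demand theta (take p s) + nmax theta)%N].
Proof.
move=> hcap rho0 vpE ssort; rewrite /greedy_choice.
case: leqP => [le_s|lt_s].
  by exists (size s); rewrite take_size ltnn; split.
set a := (fun m => (C < total_demand theta (take m.+1 s))%N).
set p := seq.find a _.
have has_a : has a (iota 0 (size s)).
  apply/hasP; exists (size s).-1; last first.
    rewrite /a; case: s lt_s {ssort p a} => [|i s] //= lt_s.
    by rewrite take_size.
  rewrite mem_iota /=; case: s lt_s {ssort p a} => [|i s] //=.
  by rewrite /total_demand big_nil.
have lt_p : (p < size s)%N by rewrite -(size_iota 0 (size s)) -has_find.
have ap : (C < total_demand theta (take p.+1 s))%N.
  by have := nth_find 0 has_a; rewrite -/p nth_iota.
have take_le : (total_demand theta (take p s) <= C)%N.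
  case: (posnP p) => [->|p0]; first by rewrite take0 /total_demand big_nil.
  have lt_p1 : (p.-1 < p)%N by rewrite prednK.
  have := before_find 0 lt_p1.
  rewrite nth_iota ?(ltn_trans lt_p1) // /a add0n prednK // => /negbT.
  by rewrite -leqNgt.
have [i0 _] : exists i0, i0 \in s.
  by move: (lt_p); case: (s) => // i0 s' _; exists i0; rewrite mem_head.
rewrite (drop_nth i0 lt_p); set k := nth i0 s p.
have tkE : take p.+1 s = rcons (take p s) k by rewrite (take_nth i0).
have le_k : forall i, i \in take p s -> rho k <= rho i.
  have tr : transitive (fun i j : 'I_n => rho j <= rho i).
    by move=> j i l ij jl; apply: le_trans jl ij.
  move=> i ip; move: ssort; rewrite sorted_pairwise //.
  rewrite -{1}(cat_take_drop p s) (drop_nth i0 lt_p) -/k pairwise_cat.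
  by move=> /and3P[/allrelP le_td _ _]; apply: le_td ip (mem_head _ _).
have sumE : (C < total_demand theta (take p s) + dem k)%N.
  move: ap; rewrite tkE -cats1 total_demand_cat.
  by rewrite {2}/total_demand big_seq1.
(* The prefix demands at least [C.+1 - dem k], hence at least [nmax theta] by [hcap]. *)
have le_dem : (dem k <= total_demand theta (take p s))%N.
  have := demand_le_nmax k; lia.
have -> : vp k <= \sum_(i <- take p s) vp i.
  rewrite vpE; apply: (@le_trans _ _ (\sum_(i <- take p s) (dem i)%:R * rho k)).
    by rewrite -mulr_suml -natr_sum ler_wpM2r // ler_nat.
  rewrite big_seq [leRHS]big_seq; apply: ler_sum => i ip.
  by rewrite vpE ler_wpM2l // le_k.
exists p; split => // _.
by apply: leq_trans sumE _; rewrite leq_add2l demand_le_nmax.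
Qed.

End GreedyChoice.

(** * One round of the mechanism as the choice of a set of jobs *)

Section Decide.
Context (R : realType) (f : R -> R) (tie : rel (candidate R)).
Context (tie_total : total tie) (tie_trans : transitive tie).
Context (C n : nat) (theta : n.-tuple (job R)).
Context (f_ge0 : forall d, 0 <= f d).
Context (demand_gt0 : forall i, (0 < demand (tnth theta i))%N).
Context (value_gt0 : forall i, 0 < value (tnth theta i)).
Context (hcap : (2 * nmax theta <= C.+1)%N).

(** This and the next two definitions name the local [fin], the membership test of [JF] and [rhop]
    of [decide]. *)
Definition completed_by (st : state R n) (t : R) : {set 'I_n} :=
  (finished st :|:
    [set i | if start st i is Some s then s + len (tnth theta i) <= t
             else false])%SET.

Definition eligible (st : state R n) (t : R) (i : 'I_n) : bool :=
  [&& release (tnth theta i) <= t,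
      (1 - fraction theta st t i) * len (tnth theta i)
        <= deadline (tnth theta i) - t
    & i \notin completed_by st t].

Definition density (st : state R n) (t : R) (i : 'I_n) : R :=
  value (tnth theta i) / (demand (tnth theta i))%:R
  * f (fraction theta st t i).

(** All that is used later about the choice made in a round: sorting and ties disappear, and a job
    left out is outranked, up to equality, by chosen jobs of total demand above [C - nmax]. *)
Lemma decideP st t : exists X : {set 'I_n},
  [/\ forall i, start (decide f tie C theta st t) i =
        if i \in X then Some (odflt t (start st i)) else None,
      forall i, i \in X -> eligible st t i,
      (\sum_(i in X) demand (tnth theta i) <= C)%N
    & forall i, eligible st t i -> i \notin X ->
        (C < \sum_(j in X) demand (tnth theta j) + nmax theta)%N /\
        (forall j, j \in X -> density st t i <= density st t j)].
Proof.
rewrite /decide; set before := (fun i j : 'I_n => _ || _).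
set vp := (fun i => _ * f _); set s := sort _ _ => /=.
have before_total : total before.
  by move=> i j; rewrite /before; case: ltgtP => //= _; apply: tie_total.
have before_trans : transitive before.
  move=> j i k; rewrite /before => /orP[ij|/andP[/eqP ij tij]].
    move=> /orP[jk|/andP[/eqP jk _]]; first by rewrite (lt_trans jk ij).
    by rewrite -jk ij.
  move=> /orP[jk|/andP[/eqP jk tjk]]; first by rewrite ij jk.
  by rewrite ij jk eqxx (tie_trans tij tjk) orbT.
have before_dens i j : before i j -> density st t j <= density st t i.
  by move=> /orP[/ltW|/andP[/eqP ij _]] //; rewrite /density -ij.
have ss : sorted before s by apply: sort_sorted.
have us : uniq s by rewrite sort_uniq filter_uniq // enum_uniq.
have sE i : (i \in s) = eligible st t i.
  by rewrite mem_sort mem_filter mem_enum andbT.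
have [|||p [-> le_C lt_C]] :=
    @greedy_choice_prefix R C n theta (density st t) vp s hcap.
- by move=> i; rewrite mulr_ge0 // divr_ge0 // ltW.
- move=> i; rewrite /vp /density mulrA mulrCA divff ?mulr1 // pnatr_eq0.
  by rewrite -lt0n.
- by apply: sub_sorted ss => i j; apply: before_dens.
exists [set i in take p s]%SET.
have sumE : (\sum_(i in [set i in take p s]%SET) demand (tnth theta i))%N =
    total_demand theta (take p s).
  rewrite /total_demand (big_uniq _ (take_uniq p us)) /=.
  by apply: eq_bigl => i; rewrite inE.
split; rewrite ?sumE //.
- by move=> i; rewrite inE; case: ifP => // _; case: (start st i).
- by move=> i; rewrite inE => /mem_take; rewrite sE.
move=> i; rewrite -sE inE => iS iN.
have idrop : i \in drop p s.
  by move: iS; rewrite -{1}(cat_take_drop p s) mem_cat (negbTE iN).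
split.
  apply: lt_C; rewrite ltnNge; apply/negP => le_p.
  by rewrite drop_oversize in idrop.
move=> j; rewrite inE => jt; apply: before_dens.
move: ss; rewrite -(cat_take_drop p s) sorted_pairwise // pairwise_cat.
by move=> /and3P[/allrelP + _ _]; apply.
Qed.

End Decide.

(** * Critical times and discounted demand *)

Section NextCritical.
Context (R : realType) (n : nat) (theta : n.-tuple (job R)).

Definition critical_times (st : state R n) : seq R :=
  [seq t <- [seq release (tnth theta i) | i <- enum 'I_n] ++
    pmap (fun i => omap (fun s => s + len (tnth theta i)) (start st i))
         (enum 'I_n) | now st < t].

Lemma release_critical st i : now st < release (tnth theta i) ->
  release (tnth theta i) \in critical_times st.
Proof.
move=> h; rewrite mem_filter h mem_cat; apply/orP; left.
by apply: map_f; rewrite mem_enum.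
Qed.

Lemma completion_critical st i s : start st i = Some s ->
  now st < s + len (tnth theta i) ->
  s + len (tnth theta i) \in critical_times st.
Proof.
move=> sE h; rewrite mem_filter h mem_cat; apply/orP; right.
rewrite mem_pmap; apply/mapP; exists i; first by rewrite mem_enum.
by rewrite sE.
Qed.

Lemma next_critical_min st t t' :
  next_critical theta st = Some t -> t' \in critical_times st -> t <= t'.
Proof.
rewrite /next_critical -/(critical_times st).
case: (critical_times st) => //= t0 ts [<-].
rewrite inE => /orP[/eqP ->|].
  by elim: ts => //= t1 ts IH; rewrite ge_min IH orbT.
elim: ts => //= t1 ts IH; rewrite inE ge_min => /orP[/eqP ->|/IH ->].
  by rewrite lexx.
by rewrite orbT.
Qed.

Lemma next_critical_none st t :
  next_critical theta st = None -> t \notin critical_times st.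
Proof.
by rewrite /next_critical -/(critical_times st); case: (critical_times st).
Qed.

End NextCritical.

(** * Exponential growth and demand per unit of time *)

Section Window.
Context (R : realType) (x : R) (kappa : nat).
Context (x_gt1 : 1 < x) (kappa_gt0 : (0 < kappa)%N).

(** The [Y] of the overview, with [x] for [chi]: the priority gained in time [t] by a running job of
    the maximal length [kappa]. *)
Definition growth (t : R) : R := x `^ (t / kappa%:R).

Let x_gt0 : 0 < x. Proof. exact: lt_trans x_gt1. Qed.

Lemma growth_gt0 t : 0 < growth t. Proof. exact: powR_gt0. Qed.

Lemma growthD s t : growth (s + t) = growth s * growth t.
Proof. by rewrite /growth mulrDl powRD // (gt_eqF x_gt0) implybT. Qed.

Lemma growth0 : growth 0 = 1. Proof. by rewrite /growth mul0r powRr0. Qed.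

Lemma growthN t : growth (- t) = (growth t)^-1.
Proof. by rewrite /growth mulNr powRN. Qed.

Lemma powR_ltr : {homo powR x : s t / s < t}.
Proof.
move=> s t st; rewrite /powR gt_eqF // ltr_expR ltr_pM2r //; exact: ln_gt0.
Qed.

Lemma growth_lt s t : s < t -> growth s < growth t.
Proof. by move=> st; apply: powR_ltr; rewrite ltr_pM2r // invr_gt0 ltr0n. Qed.

Lemma growth_le s t : s <= t -> growth s <= growth t.
Proof. by rewrite le_eqVlt => /orP[/eqP ->//|/growth_lt/ltW]. Qed.

Lemma growth_gt1 : 1 < growth 1.
Proof. by rewrite -[ltLHS]growth0; apply: growth_lt. Qed.

Lemma growthn m : growth m%:R = growth 1 ^+ m.
Proof.
elim: m => [|m IH]; first by rewrite growth0 expr0.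
by rewrite -natr1 growthD IH exprSr.
Qed.

Lemma growth_kappa : growth kappa%:R = x.
Proof.
by rewrite /growth divff ?powRr1 ?(ltW x_gt0) // pnatr_eq0 -lt0n.
Qed.

Context (C n : nat) (theta : n.-tuple (job R)) (a : allocation R n).
Context (a_feas : feasible C a) (O : pred 'I_n) (s : 'I_n -> R).
Context (s_ge0 : forall i, O i -> 0 <= s i).
Context (a_dem : forall i t, O i -> s i <= t < s i + 1 ->
  (demand (tnth theta i) <= a i t)%N).

(** Each counted job holds its instances for a full unit of time, so all of them are active at the
    latest of their starts, where feasibility applies. *)
Lemma unit_window (e : R) :
  (\sum_(i | [&& O i, (e - 1 <= s i)%R & (s i < e)%R]) demand (tnth theta i)
    <= C)%N.
Proof.
pose P i := [&& O i, e - 1 <= s i & s i < e]; 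
case: (pickP P) => [i0 Pi0|P0]; last by rewrite (eq_bigl _ _ P0) big_pred0_eq.
have [i1 /and3P[Oi1 ge1 lt1] imax] := arg_maxP s Pi0.
apply: (@leq_trans (\sum_(i < n) a i (s i1))); last exact/a_feas/s_ge0.
rewrite [leqRHS](bigID P) /=; apply: leq_trans (leq_addr _ _).
apply: leq_sum => i Pi; have /and3P[Oi gei lti] := Pi.
by apply: a_dem => //; apply/andP; split; [exact: imax|lra].
Qed.

(* Cutting time into unit windows ending at [e], the demands of the jobs
   started in one window sum to at most [C]: geometric series. *)
Lemma discounted_demand (e : R) :
  \sum_(i | O i && (s i < e)) (demand (tnth theta i))%:R * growth (s i - e)
    <= C%:R * (growth 1 / (growth 1 - 1)).
Proof.
have y1 := growth_gt1.
(* Induction on a natural upper bound of [e]: for [e <= 0] nothing starts before [e], and each step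
   peels off the last window. *)
have [m le_e] : exists m : nat, e <= m%:R.
  exists (Num.truncn `|e|).+1; apply: le_trans (ler_norm e) _.
  by apply/ltW/truncnS_gt.
elim: m e le_e => [|m IH] e le_e.
  rewrite big_pred0.
    rewrite mulr_ge0 // divr_ge0 ?subr_ge0 ?(ltW y1) //.
    exact/ltW/growth_gt0.
  move=> i; apply/negP => /andP[/s_ge0 s0 lt_s].
  by have := lt_le_trans (le_lt_trans s0 lt_s) le_e; rewrite ltxx.
rewrite (bigID (fun i => e - 1 <= s i)) /=.
(* The sum [G = y / (y - 1)] of the series satisfies [G = 1 + G / y]. *)
have -> : C%:R * (growth 1 / (growth 1 - 1)) =
    C%:R + (growth 1)^-1 * (C%:R * (growth 1 / (growth 1 - 1))) :> R.
  by field; rewrite subr_eq0 !gt_eqF ?growth_gt0.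
apply: lerD.
  apply: le_trans (_ : _ <= (\sum_(i | [&& O i, (e - 1 <= s i)%R & (s i < e)%R])
      demand (tnth theta i))%:R) _; last by rewrite ler_nat unit_window.
  rewrite natr_sum.
  rewrite [leRHS](eq_bigl (fun i => (O i && (s i < e)) && (e - 1 <= s i))).
    apply: ler_sum => i /andP[/andP[_ lt_s] _]; rewrite ler_piMr //.
    by rewrite -growth0 growth_le // subr_le0 ltW.
  by move=> i; rewrite -andbA; congr (_ && _); rewrite andbC.
rewrite (eq_bigl (fun i => O i && (s i < e - 1))); last first.
  move=> i; rewrite -andbA -ltNge; congr (_ && _).
  by apply/andP/idP => [[]//|h]; split=> //; lra.
apply: le_trans (_ : _ <= (growth 1)^-1 * \sum_(i | O i && (s i < e - 1))
  (demand (tnth theta i))%:R * growth (s i - (e - 1))) _.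
  rewrite mulr_sumr; apply: ler_sum => i _.
  rewrite mulrCA -growthN -growthD.
  by rewrite (_ : - 1 + (s i - (e - 1)) = s i - e) //; ring.
rewrite ler_wpM2l ?invr_ge0 ?(ltW (growth_gt0 _)) //; apply: IH.
by rewrite lerBlDr natr1.
Qed.

End Window.

(** * Upper bound *)

Section Trace.
Context (R : realType) (x : R) (kappa : nat).
Context (x_gt1 : 1 < x) (kappa_gt0 : (0 < kappa)%N).
Context (tie : rel (candidate R)).
Context (tie_total : total tie) (tie_trans : transitive tie).
Context (C n : nat) (theta : n.-tuple (job R)).
Context (valid : forall i, valid_job kappa (tnth theta i)).
Context (hcap : (2 * nmax theta <= C.+1)%N).

Local Notation f := (fun delta : R => x `^ delta).
Local Notation Y := (growth x kappa).
Local Notation J i := (tnth theta i).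
Local Notation rho i := (value (J i) / (demand (J i))%:R).

Let x_gt0 : 0 < x. Proof. exact: lt_trans x_gt1. Qed.

Lemma len_ge1 i : 1 <= len (J i). Proof. by case: (valid i) => _ _ /andP[]. Qed.

Lemma len_gt0 i : 0 < len (J i).
Proof. exact: lt_le_trans ltr01 (len_ge1 i). Qed.

Lemma len_le i : len (J i) <= kappa%:R.
Proof. by case: (valid i) => _ _ /andP[]. Qed.

Lemma demand_pos i : (0 < demand (J i))%N. Proof. by case: (valid i). Qed.

Lemma value_pos i : 0 < value (J i). Proof. by case: (valid i). Qed.

Lemma rho_gt0 i : 0 < rho i.
Proof. by rewrite divr_gt0 ?value_pos // ltr0n demand_pos. Qed.

Definition wf_state (st : state R n) : Prop :=
  -1 <= now st /\ forall i s, start st i = Some s ->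
  [/\ release (J i) <= s, s <= now st, now st < s + len (J i),
      s + len (J i) <= deadline (J i) & i \notin finished st].

(** Turns the feasibility test of a running job into [s + len (J i) <= deadline (J i)], independent
    of [t]: the job stays eligible until it completes. *)
Lemma fraction_len (st : state R n) t i s : start st i = Some s ->
  (1 - fraction theta st t i) * len (J i) = s + len (J i) - t.
Proof.
move=> sE; rewrite /fraction sE mulrBl divfK ?gt_eqF ?len_gt0 //; ring.
Qed.

Lemma eligible_running st t i s : wf_state st -> now st < t ->
  start st i = Some s -> i \notin completed_by theta st t ->
  eligible theta st t i.
Proof.
move=> [_ wf] lt_t sE iN; have [rs sn _ sd _] := wf _ _ sE.
rewrite /eligible iN andbT (fraction_len _ sE); apply/andP; split; lra.
Qed.

Lemma wf_decide st t : wf_state st -> now st < t ->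
  wf_state (decide f tie C theta st t).
Proof.
move=> [now1 wf] lt_t; split=> [|i s]; first by rewrite /=; lra.
have [X [-> elX _ _]] := decideP tie_total tie_trans
  (fun d => powR_ge0 x d) demand_pos value_pos hcap st t.
case: ifP => // /elX /and3P[rt dt iN] [<-].
have l0 := len_gt0 i.
case E: (start st i) => [s'|] /=; last first.
  by move: dt; rewrite /fraction E subr0 mul1r => dt; split=> //; lra.
have [rs sn _ sd _] := wf _ _ E; split=> //; first lra.
by move: iN; rewrite !inE E negb_or -ltNge => /andP[].
Qed.

(** The fraction grows at rate [1 / len (J j)], which is at least [1 / kappa]. *)
Lemma density_step st t j s : now st <= t -> start st j = Some s ->
  density f theta st (now st) j * Y (t - now st) <= density f theta st t j.
Proof.
move=> le_t sE; rewrite /density -mulrA ler_wpM2l ?(ltW (rho_gt0 _)) //.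
rewrite /fraction sE /growth -powRD; last by rewrite (gt_eqF x_gt0) implybT.
rewrite ler_powR ?(ltW x_gt1) //.
have -> : (t - s) / len (J j) =
    (now st - s) / len (J j) + (t - now st) / len (J j).
  by rewrite -mulrDl; congr (_ / _); ring.
rewrite lerD2l ler_wpM2l ?subr_ge0 // lef_pV2 ?posrE ?ltr0n ?len_gt0 //.
exact: len_le.
Qed.

(** * Jobs whose priority density stays above a growing threshold *)

Section Threshold.
Context (e : 'I_n -> R) (t0 c : R).
(** In [charge_job], [c] is the density of a job lost by the mechanism and [t0] its start in the
    optimum. By [density_step] a job above [thr] stays above it while it runs. *)
Let thr t := c * Y (t - t0).

Definition running_above st j :=
  (start st j != None) && (thr (now st) <= density f theta st (now st) j).

(** A job completing at [e j] has fraction [1] then, hence priority density [rho j * x]. *)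
Definition good st j :=
  running_above st j ||
  [&& j \in finished st, t0 < e j & thr (e j) <= rho j * x].

Let thrD s t : thr t = thr s * Y (t - s).
Proof. by rewrite /thr -mulrA -growthD //; congr (_ * Y _); ring. Qed.

Lemma density_decide st t i :
  start (decide f tie C theta st t) i != None ->
  density f theta (decide f tie C theta st t) t i = density f theta st t i.
Proof.
have [X [sE _ _ _]] := decideP tie_total tie_trans
  (fun d => powR_ge0 x d) demand_pos value_pos hcap st t.
rewrite sE; case: ifP => // iX _; rewrite /density /fraction sE iX.
by case: (start st i) => //=; rewrite subrr mul0r.
Qed.

(** If [i] is not chosen, [decideP] makes every chosen job at least as dense as [i], hence good, and
    their demand exceeds [C - nmax]. *)
Lemma above_decide st t i : eligible theta st t i ->
  thr t <= density f theta st t i ->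
  let st' := decide f tie C theta st t in
  running_above st' i \/
  (C < \sum_(j | good st' j) demand (J j) + nmax theta)%N.
Proof.
move=> el le_thr st'; have dE := @density_decide st t.
have [X [sE _ _ hX]] := decideP tie_total tie_trans
  (fun d => powR_ge0 x d) demand_pos value_pos hcap st t.
have sX j : j \in X -> start st' j != None by rewrite sE => ->.
have [iX|iN] := boolP (i \in X); [left|right].
  by rewrite /running_above sX //= dE ?sX.
have [lt_C le_d] := hX _ el iN.
apply: leq_trans lt_C _; rewrite leq_add2r.
rewrite [leqRHS](bigID (mem X)) /=; apply: leq_trans (leq_addr _ _).
rewrite [leqRHS](eq_bigl (mem X)) // => j /=; apply: andb_idl => jX.
apply/orP; left; rewrite /running_above sX //= dE ?sX //.
exact: le_trans le_thr (le_d _ jX).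
Qed.

Lemma running_step st t i : wf_state st -> next_critical theta st = Some t ->
  running_above st i ->
  let st' := decide f tie C theta st t in
  [\/ i \in finished st' /\ thr t <= rho i * x,
      running_above st' i
    | (C < \sum_(j | good st' j) demand (J j) + nmax theta)%N].
Proof.
move=> wf nE /andP[]; case sE: (start st i) => [s|] // _ le_thr st'.
have [lt_t _] := next_criticalP nE.
have le_t : thr t <= density f theta st t i.
  apply: le_trans (density_step (ltW lt_t) sE).
  by rewrite (thrD (now st)) ler_wpM2r // ltW // growth_gt0.
have [iF|iN] := boolP (i \in finished st').
  constructor 1; split=> //; apply: le_trans le_t _.
  have [_ wfi] := wf; have [_ _ lt_s _ iN] := wfi _ _ sE.
  (* The completion of [i] is itself critical, so the next critical time cannot jump past it. *)
  have st_t : s + len (J i) = t.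
    apply/le_anti/andP; split.
      by move: iF; rewrite /= !inE (negbTE iN) sE.
    apply: (next_critical_min nE); exact: completion_critical.
  rewrite /density /fraction sE -st_t addrC addKr divff.
    by rewrite powRr1 // ltW.
  by rewrite gt_eqF // len_gt0.
have el := eligible_running wf lt_t sE iN.
by have [] := above_decide el le_t; [constructor 2|constructor 3].
Qed.

(** Either every good job stays good, or one is dropped while above the threshold, and then
    [running_step] provides enough demand anew. *)
Lemma good_step st t : wf_state st -> next_critical theta st = Some t ->
  t0 < t ->
  let st' := decide f tie C theta st t in
  (forall j, j \in finished st' -> j \notin finished st -> e j = t) ->
  (C < \sum_(j | good st j) demand (J j) + nmax theta)%N ->
  (C < \sum_(j | good st' j) demand (J j) + nmax theta)%N.
Proof.
move=> wf nE t0t st' eE lt_C.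
have [//|le_C] := ltnP C (\sum_(j | good st' j) demand (J j) + nmax theta).
suff sub : forall j, good st j -> good st' j.
  have : (\sum_(j | good st j) demand (J j) <=
          \sum_(j | good st' j) demand (J j))%N.
    rewrite [leqRHS](bigID (good st)) /=; apply: leq_trans (leq_addr _ _).
    by rewrite [leqRHS](eq_bigl (good st)) // => j; apply/andb_idl/sub.
  by move: lt_C le_C; lia.
move=> j /orP[ra|/and3P[jF ej le_j]]; last first.
  by apply/orP; right; rewrite ej le_j !andbT /= !inE jF.
have [_ wfj] := wf; have jN : j \notin finished st.
  by case/andP: ra; case E: (start st j) => // _ _; case: (wfj _ _ E).
have [[jF le_j]|ra'|] := running_step wf nE ra.
- by apply/orP; right; rewrite (eE j jF jN) jF t0t.
- by apply/orP; left.
- by rewrite ltnNge le_C.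
Qed.

End Threshold.

(** * Charging the jobs that the mechanism loses *)

Local Notation st k := (iter k (gstep f tie C theta) (init_state R n)).

Lemma wf_iter k : wf_state (st k).
Proof.
elim: k => [|k IH] //=; rewrite /gstep.
case E: (next_critical theta _) => [t|] //.
by apply: wf_decide => //; case: (next_criticalP E).
Qed.

Lemma finished_mono k m : (k <= m)%N ->
  finished (st k) \subset finished (st m).
Proof.
move=> /subnK <-; elim: (m - k)%N => [|p IH] //=.
apply: fintype.subset_trans IH _; rewrite /gstep.
case: (next_critical theta _) => [t|] //=; exact: finset.subsetUl.
Qed.

(** The time of the first state in which [j] is finished; for a job that never completes, [find]
    returns the size of the list and the value is arbitrary. *)
Definition finish_time (j : 'I_n) : R :=
  now (st (find (fun k => j \in finished (st k)) (iota 0 (n + n).+1))).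

Lemma finish_timeE k j : (k < n + n)%N -> j \notin finished (st k) ->
  j \in finished (st k.+1) -> finish_time j = now (st k.+1).
Proof.
move=> lt_k jN jF; rewrite /finish_time; congr (now (iter _ _ _)).
have -> : (n + n).+1 = (k.+1 + ((n + n) - k))%N by lia.
rewrite iotaD find_cat size_iota add0n.
have -> : ((n + n) - k = (n + n - k).-1.+1)%N by lia.
rewrite [iota k.+1 _]/= [find _ (_ :: _)]/= jF addn0.
case: hasP => // -[p]; rewrite mem_iota /= ltnS => le_p jp; case/negP: jN.
exact: (fintype.subsetP (finished_mono le_p)).
Qed.

Let W := finished (final_state f tie C theta).

(** Follow the rounds from the release of [i] on: either [i] itself runs above the threshold, or
    good jobs demand at least [C.+1 - nmax]. At the end nothing runs and [i] is not completed, so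
    the good jobs are all completed, and each pays for its demand. *)
Lemma charge_job i t0 : release (J i) <= t0 ->
  t0 + len (J i) <= deadline (J i) -> i \notin W ->
  (C.+1 - nmax theta)%:R * rho i <=
    \sum_(j in W | t0 < finish_time j)
       x * (value (J j) * Y (t0 - finish_time j)).
Proof.
move=> r_t0 t0_d iW.
pose c := rho i; have c0 : 0 <= c by exact/ltW/rho_gt0.
pose G s := good finish_time t0 c s.
pose A s := running_above t0 c s i \/
  (C < \sum_(j | G s j) demand (J j) + nmax theta)%N.
have Inv k : (k <= n + n)%N -> now (st k) < release (J i) \/ A (st k).
  elim: k => [|k IH] lt_k.
    by left; rewrite /=; case: (valid i) => + _ _ _; lra.
  have iN : i \notin finished (st k.+1).
    by apply: contraNN iW; apply/fintype.subsetP; apply: finished_mono.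
  have eE j := @finish_timeE k j lt_k.
  move: iN eE (IH (ltnW lt_k)); rewrite iterS {2 3 4}/gstep.
  rewrite [gstep _ _ _ _ _]/gstep.
  have wf := wf_iter k; set s := st k in wf *.
  case E: (next_critical theta s) => [t|] //= iN eE IHk.
  have [lt_r|le_r] := ltP t (release (J i)); [by left|right].
  have [lt_t _] := next_criticalP E.
  have iN0 : i \notin finished s.
    by apply: contraNN iN; apply/fintype.subsetP; apply: finset.subsetUl.
  (* Up to [t0] job [i] can still be completed in time, so it is eligible, and the threshold is at
     most [c]. After [t0] the previous state is used. *)
  have [le_t0|lt_t0] := leP t t0.
    have dens_ge : c <= density f theta s t i.
      rewrite /density -/c ler_peMr // -(powRr0 x) ler_powR ?(ltW x_gt1) //.
      rewrite /fraction; case sE: (start s i) => [u|] //.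
      have [_ wfi] := wf; have [_ ? _ _ _] := wfi _ _ sE.
      by rewrite divr_ge0 ?(ltW (len_gt0 _)) //; lra.
    apply: above_decide.
      rewrite /eligible iN le_r andbT /=.
      case sE: (start s i) => [u|]; last first.
        by rewrite /fraction sE; lra.
      have [_ wfi] := wf; have [_ ? _ _ _] := wfi _ _ sE.
      by rewrite (fraction_len _ sE); lra.
    apply: le_trans dens_ge; rewrite ler_piMr // -(growth0 x kappa).
    by rewrite growth_le // subr_le0.
  have [lt_rn|[ra|lt_C]] := IHk.
  - have := next_critical_min E (release_critical lt_rn); lra.
  - have [[iF _]|ra'|] := running_step finish_time wf E ra; [|by left|by right].
    by rewrite iF in iN.
  - right; apply: (good_step wf E) => // j jF jN; exact: eE.
have nE := next_critical_final f tie C theta; have := Inv _ (leqnn _).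
rewrite -/(final_state f tie C theta).
set s := final_state f tie C theta in nE *.
(* A running job would leave its completion as a later critical time. *)
have no_run j : start s j = None.
  case sE: (start s j) => [u|] //.
  have [_ wfj] := wf_iter (n + n); have [_ _ lt_u _ _] := wfj _ _ sE.
  have := next_critical_none (u + len (J j)) nE.
  by rewrite (completion_critical sE).
case=> [lt_r|[/andP[]|lt_C]]; last 2 first.
- by rewrite no_run.
- have le_C : (C.+1 - nmax theta <= \sum_(j | G s j) demand (J j))%N by lia.
  apply: (@le_trans _ _ ((\sum_(j | G s j) demand (J j))%:R * c)).
    by rewrite ler_wpM2r // ler_nat.
  rewrite natr_sum mulr_suml.
  have GE j : G s j -> [&& j \in W, t0 < finish_time j &
      c * Y (finish_time j - t0) <= rho j * x].
    by rewrite /G /good /running_above no_run.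
  rewrite [leRHS](bigID (G s)) /=; apply: ler_wpDr.
    apply: sumr_ge0 => j _; rewrite !mulr_ge0 ?(ltW x_gt0) //.
      exact/ltW/value_pos.
    exact/ltW/growth_gt0.
  rewrite [leRHS](eq_bigl (G s)); last first.
    by move=> j; apply: andb_idl => /GE/and3P[-> ->].
  apply: ler_sum => j /GE/and3P[_ _ le_j].
  rewrite -opprB growthN mulrA ler_pdivlMr ?growth_gt0 // -mulrA.
  apply: le_trans (_ : _ <= (demand (J j))%:R * (rho j * x)) _.
    by rewrite ler_wpM2l.
  rewrite le_eqVlt; apply/orP; left; apply/eqP; field.
  by rewrite pnatr_eq0 -lt0n demand_pos.
- by have := next_critical_none (release (J i)) nE; rewrite release_critical.
Qed.

(** Jobs completed by both sides account for the [+ 1]. The others are charged by [charge_job];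
    after exchanging the sums, each completed [j] carries a discounted demand of the optimum,
    bounded by [discounted_demand]. *)
Lemma greedy_upper_bound :
  OPT C theta <=
    (C%:R / (C.+1 - nmax theta)%:R * (x * (Y 1 / (Y 1 - 1))) + 1)
    * greedy_welfare f tie C theta.
Proof.
have [a a_feas ->] := OPT_max C theta.
(* Start times in the optimal allocation, with default [0] for jobs it does not complete. *)
have [s sP] : exists s : 'I_n -> R, forall i, completed theta a i ->
    [/\ release (J i) <= s i, s i + len (J i) <= deadline (J i)
      & forall t, s i <= t < s i + len (J i) -> (demand (J i) <= a i t)%N].
  exists (fun i => if pselect (completed theta a i) is left ci
                   then projT1 (cid ci) else 0) => i ci.
  by case: pselect => // ci'; case: (cid ci').
set u := (C.+1 - nmax theta)%N.
have u_gt0 : (0 < u)%N by rewrite subn_gt0; lia.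
pose O i := `[< completed theta a i >] && (i \notin W).
have OP i : O i -> completed theta a i by case/andP => /asboolP.
have WE : greedy_welfare f tie C theta = \sum_(j in W) value (J j) by [].
rewrite /welfare (bigID (mem W)) /= addrC mulrDl mul1r; apply: lerD; last first.
  rewrite WE [leRHS](bigID (fun i => `[< completed theta a i >])) /=.
  apply: ler_wpDr; first by apply: sumr_ge0 => i _; apply/ltW/value_pos.
  by rewrite le_eqVlt; apply/orP; left; apply/eqP/eq_bigl => i; rewrite andbC.
apply: (@le_trans _ _ (\sum_(i | O i) (demand (J i))%:R / u%:R *
    \sum_(j in W | s i < finish_time j)
       x * (value (J j) * Y (s i - finish_time j)))).
  apply: ler_sum => i Oi; have [rs sd _] := sP _ (OP _ Oi).
  have := charge_job rs sd (andP Oi).2.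
  rewrite -/u => le_i.
  apply: le_trans (_ : _ <= (demand (J i))%:R / u%:R * (u%:R * rho i)) _.
    rewrite le_eqVlt; apply/orP; left; apply/eqP; field.
    by rewrite !pnatr_eq0 -!lt0n demand_pos.
  by rewrite ler_wpM2l // divr_ge0.
rewrite WE mulr_sumr.
under eq_bigr do rewrite mulr_sumr.
rewrite (exchange_big_dep (mem W)) /=; last by move=> i j _ /andP[].
apply: ler_sum => j jW.
apply: (@le_trans _ _ (x * value (J j) / u%:R *
   \sum_(i | O i && (s i < finish_time j))
      (demand (J i))%:R * Y (s i - finish_time j))).
  rewrite mulr_sumr jW le_eqVlt; apply/orP; left; apply/eqP.
  by apply: eq_bigr => i _; ring.
have y1 := growth_gt1 x_gt1 kappa_gt0.
apply: le_trans
  (ler_wpM2l _ (discounted_demand x_gt1 kappa_gt0 a_feas _ _ _)) _.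
- by rewrite divr_ge0 // mulr_ge0 // ltW // value_pos.
- by move=> i /OP /sP[+ _ _]; apply: le_trans; case: (valid i).
- move=> i t /OP /sP[_ _ +] /andP[le_t lt_t]; apply.
  by rewrite le_t (lt_le_trans lt_t) // lerD2l len_ge1.
rewrite le_eqVlt; apply/orP; left; apply/eqP; field.
by rewrite pnatr_eq0 -lt0n u_gt0 subr_eq0 gt_eqF.
Qed.

End Trace.

(** * Instances for the lower bound *)

Lemma welfare_le_OPT (R : realType) (C n : nat) (theta : n.-tuple (job R))
    (a : allocation R n) :
  (forall i, 0 <= value (tnth theta i)) -> feasible C a ->
  welfare theta a <= OPT C theta.
Proof.
move=> v0 fa; apply: ub_le_sup; last by exists a.
exists (\sum_(i < n) value (tnth theta i)) => _ [b _ <-].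
rewrite /welfare [leRHS](bigID (fun i => `[< completed theta b i >])) /=.
by apply: ler_wpDr => //; apply: sumr_ge0.
Qed.

Section Instance.
Context (R : realType) (x : R) (kappa : nat).
Context (x_gt1 : 1 < x) (kappa_gt0 : (0 < kappa)%N).
Context (tie : rel (candidate R)).
Context (tie_total : total tie) (tie_trans : transitive tie).
Context (N H n : nat) (H_gt0 : (0 < H)%N) (n_gt0 : (0 < n)%N).
Context (hcap : (2 * n <= (H * n).+1)%N).
Context (eps eta : R) (eps01 : 0 < eps < 1) (eta_gt0 : 0 < eta).

Local Notation f := (fun delta : R => x `^ delta).
Local Notation Y := (growth x kappa).
(** The last stage [m] starts at time [N] and its jobs end at [K]. The [M] long jobs leave [n - 1]
    of the [H * n] instances free, one too few for a job of demand [n]. *)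
Local Notation m := N.*2.
Local Notation M := (H * n - n).+1.
Local Notation K := (N + kappa)%N.

(** Stages last [1/2], less than the length [kappa] of the long jobs, so each stage is interrupted
    before it can complete. *)
Definition stage_time (j : nat) : R := j%:R / 2.
Local Notation tau := stage_time.

(* [inl (inl (j, _))] are the copies of the long job of stage [j], which the
   mechanism runs during that stage; [inl (inr j)] is the blocker, which keeps
   it from continuing any job of stage [j - 1] next to those of stage [j];
   [inr (i, _)] are the short jobs that the optimum runs and the mechanism
   never starts. *)
Definition label : finType :=
  ('I_m.+1 * 'I_M + 'I_m.+1 + 'I_K * 'I_H)%type.

(** At [tau j], densities relative to [Y (tau j)] are [1 + (2j+2) eta] for the long jobs of stage
    [j], [1 + (2j+1) eta] for its blocker and [1 + 2j eta] for the running jobs of stage [j - 1]; a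
    short job has [1] at its release. Deadlines leave no slack except in the last stage, which the
    optimum postpones. *)
Definition label_job (l : label) : job R :=
  match l with
  | inl (inl (j, _)) =>
      Job (tau j)
        (if j == m :> nat then K%:R + 1 + kappa%:R else tau j + kappa%:R)
        1 kappa%:R ((1 + j.*2.+2%:R * eta) * Y (tau j))
  | inl (inr j) =>
      Job (tau j) (tau j + 1) n 1
        (n%:R * ((1 + j.*2.+1%:R * eta) * Y (tau j)))
  | inr (i, _) =>
      Job (i%:R + 1 - eps) (i%:R + 1 - eps + 1) n 1
        (n%:R * Y (i%:R + 1 - eps))
  end.

Definition bad_instance : #|label|.-tuple (job R) :=
  [tuple label_job (enum_val i) | i < #|label|].
Local Notation theta := bad_instance.

Definition long (J : nat) (l : label) : bool :=
  if l is inl (inl (j, _)) then j == J :> nat else false.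

Let Y_gt0 t : 0 < Y t. Proof. exact: growth_gt0. Qed.

Lemma tnth_bad i : tnth theta i = label_job (enum_val i).
Proof. by rewrite tnth_mktuple. Qed.

Lemma big_label (T : Type) (idx : T) (op : Monoid.com_law idx) (P : pred label)
    (F : label -> T) :
  \big[op/idx]_(i < #|label| | P (enum_val i)) F (enum_val i) =
  \big[op/idx]_(l | P l) F l.
Proof.
rewrite [RHS](reindex (fun i : 'I_#|label| => enum_val i)) //.
exact/onW_bij/enum_val_bij.
Qed.

Lemma label_valid l : valid_job kappa (label_job l).
Proof.
have k1 : 1 <= kappa%:R :> R by rewrite ler1n.
have n0 : 0 < n%:R :> R by rewrite ltr0n.
have w0 k : 0 < 1 + k%:R * eta by rewrite ltr_wpDr // mulr_ge0 // ltW.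
case: l => [[[j c]|j]|[i c]] /=; split => /=; rewrite ?lexx ?k1 //.
- by rewrite divr_ge0.
- by rewrite mulr_gt0.
- by rewrite divr_ge0.
- by rewrite !mulr_gt0.
- by have := ler0n R i; case/andP: eps01; lra.
- by rewrite !mulr_gt0.
Qed.

Lemma bad_valid i : valid_job kappa (tnth theta i).
Proof. by rewrite tnth_bad; apply: label_valid. Qed.

Lemma label_demand_le l : (demand (label_job l) <= n)%N.
Proof. by case: l => [[[j c]|j]|[i c]]. Qed.

Lemma nmax_bad : nmax theta = n.
Proof.
apply/eqP; rewrite eqn_leq; apply/andP; split.
  by apply/bigmax_leqP => i _; rewrite tnth_bad label_demand_le.
have K_gt0 : (0 < K)%N by rewrite addn_gt0 kappa_gt0 orbT.
apply: leq_trans (demand_le_nmax theta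
  (enum_rank (inr (Ordinal K_gt0, Ordinal H_gt0) : label))).
by rewrite tnth_bad enum_rankK.
Qed.

Lemma sum_long J : (J <= m)%N ->
  (\sum_(l | long J l) demand (label_job l) = M)%N.
Proof.
move=> leJ; rewrite big_sumType /= [X in (_ + X)%N]big_pred0 // addn0.
rewrite big_sumType /= [X in (_ + X)%N]big_pred0 // addn0.
transitivity (\sum_(j : 'I_m.+1 | j == inord J) \sum_(c : 'I_M) 1)%N.
  rewrite pair_big /=; apply: eq_big => [[j c]|[j c] _] //=; rewrite andbT.
  apply/eqP/eqP => [jJ|->]; last by rewrite inordK.
  by apply/val_inj; rewrite /= inordK.
by rewrite big_pred1_eq sum1_card card_ord.
Qed.

Local Notation C := (H * n)%N.

Let n_le_C : (n <= C)%N. Proof. by rewrite leq_pmull. Qed.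

Let cap_bad : (2 * nmax theta <= C.+1)%N. Proof. by rewrite nmax_bad. Qed.

Let tauS j : tau j.+1 = tau j + 2^-1.
Proof. by rewrite /tau -natr1 mulrDl mul1r. Qed.

Let tau_m : tau m = N%:R.
Proof. by rewrite /tau -muln2 natrM mulfK // pnatr_eq0. Qed.

Let tau_le i j : (tau i <= tau j) = (i <= j)%N.
Proof. by rewrite /tau ler_pM2r ?invr_gt0 // ler_nat. Qed.

Let tau_lt i j : (tau i < tau j) = (i < j)%N.
Proof. by rewrite /tau ltr_pM2r ?invr_gt0 // ltr_nat. Qed.

(** * The run of the mechanism on the bad instance *)

Definition in_stage (J : nat) (t : R) : Prop :=
  [/\ (J <= m)%N, tau J <= t, (J < m)%N -> t < tau J.+1 & t < K%:R].

Local Notation lng J i := (long J (enum_val i)).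

Definition stage_state (J : nat) (st : state R #|label|) : Prop :=
  finished st = finset.set0 /\
  forall i, start st i = if lng J i then Some (tau J) else None.

Lemma longP J l : long J l ->
  [/\ release (label_job l) = tau J, len (label_job l) = kappa%:R,
      demand (label_job l) = 1%N,
      value (label_job l) = (1 + J.*2.+2%:R * eta) * Y (tau J)
    & deadline (label_job l) =
        if J == m then K%:R + 1 + kappa%:R else tau J + kappa%:R].
Proof. by case: l => [[[j c]|]|] //= /eqP ->. Qed.

Lemma long_inj i j l : long i l -> long j l -> i = j.
Proof. by case: l => [[[k c]|]|] //= /eqP <- /eqP. Qed.

(** The long jobs of stage [J] outrank all other eligible jobs, so all are chosen. Jobs of demand
    [n] no longer fit, and the long jobs of the previous stage rank behind the blocker, which does
    not fit either. *)
Lemma stage_decide J st t : in_stage J t ->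
  completed_by theta st t = finset.set0 ->
  (forall i, [\/ start st i = None,
     lng J i /\ start st i = Some (tau J)
   | exists j, [/\ j.+1 = J, t = tau J, lng j i &
         start st i = Some (tau j)]]) ->
  (forall i, lng J i -> tau J < t -> start st i = Some (tau J)) ->
  stage_state J (decide f tie C theta st t).
Proof.
move=> [leJ le_t lt_t t_K] c0 run_or run.
have k0 : 0 < kappa%:R :> R by rewrite ltr0n.
have n0 : 0 < n%:R :> R by rewrite ltr0n.
have [X [sE elX le_X hX]] := decideP tie_total tie_trans
  (fun d => powR_ge0 x d) (demand_pos bad_valid) (value_pos bad_valid)
  cap_bad st t.
set w := fun k : nat => (1 + k%:R * eta) * Y t.
have w_lt k k' : (k < k')%N -> w k < w k'.
  by move=> kk'; rewrite /w ltr_pM2r // ltrD2l ltr_pM2r // ltr_nat.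
have el_dl i : start st i = None -> eligible theta st t i ->
    release (tnth theta i) <= t /\
    t + len (tnth theta i) <= deadline (tnth theta i).
  move=> sN /and3P[rt dt _]; split=> //.
  by move: dt; rewrite /fraction sN; lra.
have dens_none i : start st i = None -> density f theta st t i =
    value (tnth theta i) / (demand (tnth theta i))%:R.
  by move=> sN; rewrite /density /fraction sN powRr0 mulr1.
(* Length exactly [kappa] makes the priority grow exactly like [Y]. *)
have dens_run i j : lng j i -> start st i = Some (tau j) ->
    density f theta st t i = w j.*2.+2.
  move=> lj sj; rewrite /density /fraction sj tnth_bad.
  have [_ -> -> -> _] := longP lj.
  rewrite divr1 /w -mulrA -/(growth x kappa (t - tau j)) -growthD //.
  by congr (_ * Y _); ring.
have dens_long i : lng J i -> density f theta st t i = w J.*2.+2.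
  move=> lJ; have [tJ|lt_Jt] := eqVneq (tau J) t.
    case: (run_or i) => [sN|[_ sJ]|[j [jJ _ lj sj]]].
    - rewrite dens_none // tnth_bad; have [_ _ -> -> _] := longP lJ.
      by rewrite divr1 /w tJ.
    - exact: dens_run.
    - by move: jJ; rewrite (long_inj lj lJ) => /esym/n_Sn.
  by apply: dens_run => //; apply: run => //; rewrite lt_neqAle lt_Jt.
have el_long i : lng J i -> eligible theta st t i.
  move=> lJ; rewrite /eligible c0 inE andbT.
  have [rE lE _ _ dE] := longP lJ; rewrite tnth_bad rE dE le_t /=.
  have dl : tau J + kappa%:R <= if J == m then K%:R + 1 + kappa%:R
      else tau J + kappa%:R.
    by case: eqP => // ->; rewrite tau_m natrD; lra.
  move: (if J == m then _ else _) dl => D dl.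
  have [tJ|lt_Jt] := eqVneq (tau J) t.
    case: (run_or i) => [sN|[_ sJ]|[j [jJ _ lj sj]]].
    - by rewrite /fraction sN lE; lra.
    - by rewrite -tnth_bad (fraction_len bad_valid _ sJ) tnth_bad lE; lra.
    - by move: jJ; rewrite (long_inj lj lJ) => /esym/n_Sn.
  have sJ : start st i = Some (tau J).
    by apply: run => //; rewrite lt_neqAle lt_Jt.
  by rewrite -tnth_bad (fraction_len bad_valid _ sJ) tnth_bad lE; lra.
have stageE j : (j <= m)%N -> tau j <= t -> (j <= J)%N.
  move=> jm jt; rewrite leqNgt; apply/negP => Jj.
  have := lt_t (leq_trans Jj jm); rewrite ltNge.
  by rewrite (le_trans _ jt) // tau_le.
have other i : eligible theta st t i -> ~~ lng J i ->
    density f theta st t i < w J.*2.+2 /\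
    (demand (tnth theta i) = n \/
     [/\ t = tau J, (0 < J)%N & density f theta st t i = w J.*2]).
  move=> el nJ; case: (run_or i) => [sN|[lJ]|[j [jJ tJ lj sj]]].
  - have [rt dt] := el_dl _ sN el; rewrite dens_none //.
    move: rt dt nJ; rewrite tnth_bad.
    case: (enum_val i) => [[[j c]|j]|[j c]] /=.
    + move=> rt dt jJ; have := stageE j (ltn_ord j) rt.
      rewrite leq_eqVlt (negbTE jJ) /= => lt_j.
      have tjJ : tau j < tau J by rewrite tau_lt.
      have jm : (nat_of_ord j == m) = false.
        by rewrite ltn_eqF // (leq_trans lt_j).
      move: dt; rewrite jm => dt; exfalso.
      have : t <= tau j by rewrite -(lerD2r kappa%:R).
      by rewrite leNgt (lt_le_trans tjJ).
    + move=> rt dt _; split; last by left.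
      have tj : t = tau j by lra.
      rewrite mulrC mulKf ?gt_eqF // -tj; apply: w_lt.
      by rewrite !ltnS leq_double stageE // -ltnS.
    + move=> rt dt _; split; last by left.
      have <- : t = j%:R + 1 - eps by lra.
      rewrite mulrC mulKf ?gt_eqF // -[ltLHS]mul1r /w ltr_pM2r //.
      by rewrite ltrDl mulr_gt0.
  - by rewrite lJ in nJ.
  - rewrite (dens_run _ _ lj sj) -jJ doubleS; split; first exact: w_lt.
    by right; split; rewrite // jJ.
pose L := [set i : 'I_#|label| | lng J i]%SET.
have sumL : (\sum_(i in L) demand (tnth theta i) = M)%N.
  rewrite -(sum_long leJ).
  under eq_bigr do rewrite tnth_bad.
  by rewrite -big_label; apply: eq_bigl => i; rewrite inE.
have dL i : i \in L -> demand (tnth theta i) = 1%N.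
  by rewrite inE tnth_bad => /longP[].
have sub_sum (A B : {set 'I_#|label|}) : A \subset B ->
    (\sum_(i in A) demand (tnth theta i) <=
     \sum_(i in B) demand (tnth theta i))%N.
  move=> /fintype.subsetP AB.
  rewrite [leqRHS](bigID (mem A)) /=; apply: leq_trans (leq_addr _ _).
  by rewrite [leqRHS](eq_bigl (mem A)) // => i /=; apply/andb_idl/AB.
(* If a long job were left out, the chosen ones would be among the other [M - 1] long jobs, whose
   demand plus [n] is only [C]. *)
have LX : L \subset X.
  apply/fintype.subsetP => i iL; apply: contraT => iX.
  have lJ : lng J i by rewrite inE in iL.
  have [lt_C le_d] := hX _ (el_long _ lJ) iX.
  have XL : X \subset L :\ i.
    apply/fintype.subsetP => j jX; rewrite !inE.
    have -> /= : j != i by apply: contraNneq iX => <-.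
    apply: contraT => nj; have [lt_d _] := other _ (elX _ jX) nj.
    by have := le_d _ jX; rewrite dens_long // leNgt lt_d.
  have sXL := sub_sum _ _ XL.
  have := sumL; rewrite (finset.big_setD1 i) //= dL // => sL.
  move: lt_C sL; rewrite nmax_bad ltnNge add1n -{1}(subnK n_le_C) leq_add2r.
  by move=> /negP lt_C [sL]; case: lt_C; rewrite -sL.
have no_n i : i \in X -> ~~ lng J i -> demand (tnth theta i) <> n.
  move=> iX nJ di; have /sub_sum : i |: L \subset X.
    by rewrite finset.subUset finset.sub1set iX.
  rewrite finset.big_setU1 ?inE //= sumL di addnS subnKC // => lt_X.
  by move: (leq_trans lt_X le_X); rewrite ltnn.
have XE i : (i \in X) = lng J i.
  apply/idP/idP => [iX|lJ]; last first.
    by apply: (fintype.subsetP LX); rewrite inE.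
  apply: contraT => nJ; have [_ [/no_n|[tJ J0 dE]]] := other _ (elX _ iX) nJ.
    by case.
  (* What remains is a long job of stage [J - 1]. The blocker [b] is eligible and too large to be
     chosen, so [decideP] forbids choosing a job of smaller density. *)
  have ltJ : (J < m.+1)%N by [].
  pose b : 'I_#|label| := enum_rank (inl (inr (Ordinal ltJ)) : label).
  have bE : tnth theta b = label_job (inl (inr (Ordinal ltJ))).
    by rewrite tnth_bad enum_rankK.
  have nb : ~~ lng J b by rewrite enum_rankK.
  have sb : start st b = None.
    case: (run_or b) => [//|[lJ]|[j [_ _ lj]]]; first by rewrite lJ in nb.
    by rewrite enum_rankK in lj.
  have elb : eligible theta st t b.
    by rewrite /eligible c0 inE andbT /fraction sb bE /= tJ; lra.
  have [/no_n|bX] := boolP (b \in X); first by move=> /(_ nb); rewrite bE.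
  have [_ /(_ i iX)] := hX _ elb bX.
  rewrite dens_none // bE /= mulrC mulKf ?gt_eqF // dE -tJ -/(w _) leNgt.
  by rewrite w_lt.
split=> // i; rewrite sE XE; case: ifP => // lJ.
case: (run_or i) => [sN|[_ ->]//|[j [jJ _ lj _]]].
  rewrite sN /=; congr Some; apply/le_anti; rewrite le_t andbT leNgt.
  by apply/negP => lt_Jt; have := run i lJ lt_Jt; rewrite sN.
by move: jJ; rewrite (long_inj lj lJ) => /esym/n_Sn.
Qed.

Definition over_state (st : state R #|label|) : Prop :=
  [/\ K%:R <= now st, finished st = [set i | lng m i]%SET
    & forall i, start st i = None].

Definition trace_inv (st : state R #|label|) : Prop :=
  [\/ st = init_state R #|label|,
      exists2 J, in_stage J (now st) & stage_state J st
    | over_state st].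

Let long_copy J : (J <= m)%N -> exists i : 'I_#|label|, lng J i.
Proof.
rewrite -ltnS => ltJ.
exists (enum_rank (inl (inl (Ordinal ltJ, ord0)) : label)).
by rewrite enum_rankK /=.
Qed.

(** No job arrives from time [K] on, which makes [over_state] final. *)
Let release_bad i : 0 <= release (tnth theta i) < K%:R.
Proof.
have -> : 0 <= release (tnth theta i) by case: (bad_valid i).
have tau_K (j : 'I_m.+1) : tau j < K%:R.
  apply: (@le_lt_trans _ _ (tau m)); first by rewrite tau_le -ltnS.
  by rewrite tau_m ltr_nat -addn1 leq_add2l.
rewrite tnth_bad; case: (enum_val i) => [[[j c]|j]|[j c]] //=.
have : (j.+1 <= K)%N by [].
by rewrite -(ler_nat R) -natr1; case/andP: eps01; lra.
Qed.

(** Before the last stage, the release of stage [J.+1] precedes any completion; in the last stage,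
    the next critical time is at most [K], when the long jobs complete. *)
Lemma stage_next J st t : in_stage J (now st) -> stage_state J st ->
  next_critical theta st = Some t -> trace_inv (decide f tie C theta st t).
Proof.
move=> [leJ le_now lt_now now_K] [F0 sE] nE.
have k1 : 1 <= kappa%:R :> R by rewrite ler1n.
have [now_t _] := next_criticalP nE.
have tauSm : tau m + kappa%:R = K%:R by rewrite tau_m natrD.
have cE i : (i \in completed_by theta st t) =
    lng J i && (tau J + kappa%:R <= t).
  rewrite !inE F0 inE sE /=; case: ifP => // lJ.
  by rewrite tnth_bad; have [_ -> _ _ _] := longP lJ.
have t_le : t <= tau J + kappa%:R.
  have [i lJ] := long_copy leJ.
  apply: (next_critical_min nE).
  have := @completion_critical _ _ theta st i (tau J).
  rewrite sE lJ tnth_bad; have [_ -> _ _ _] := longP lJ.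
  move=> -> //; case: (ltngtP J m) leJ => // [ltJ|->] _; last by rewrite tauSm.
  by have := lt_now ltJ; rewrite tauS; lra.
have c0 : t < tau J + kappa%:R -> completed_by theta st t = finset.set0.
  by move=> lt_t; apply/setP => i; rewrite cE inE leNgt lt_t andbF.
have prev : forall i, start st i = None \/ lng J i /\ start st i = Some (tau J).
  by move=> i; rewrite sE; case: ifP; [right|left].
have same : t < tau J + kappa%:R -> ((J < m)%N -> t < tau J.+1) ->
    trace_inv (decide f tie C theta st t).
  move=> lt_tk lt_t; constructor 2; exists J.
    split=> //; first by rewrite /=; lra.
    case: (ltngtP J m) leJ => // [ltJ|eJ] _; last by rewrite -tauSm -eJ.
    apply: lt_le_trans (lt_t ltJ) _; rewrite (le_trans (_ : _ <= tau m)) //.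
      by rewrite tau_le.
    by rewrite -tauSm; lra.
  apply: stage_decide (c0 lt_tk) _ _ => //.
  - split=> //; first lra.
    case: (ltngtP J m) leJ => // [ltJ|eJ] _; last by rewrite -tauSm -eJ.
    apply: lt_le_trans (lt_t ltJ) _; rewrite (le_trans (_ : _ <= tau m)) //.
      by rewrite tau_le.
    by rewrite -tauSm; lra.
  - by move=> i; case: (prev i) => ?; [constructor 1|constructor 2].
  - by move=> i lJ _; rewrite sE lJ.
case: (ltngtP J m) leJ => // [ltJ|eJ] _; last first.
  have [lt_t|le_t] := ltP t (tau J + kappa%:R).
    by apply: same => //; rewrite eJ ltnn.
  constructor 3; split.
  - by rewrite /= -tauSm -eJ.
  - by apply/setP => i; rewrite [LHS](cE i) le_t andbT inE eJ.
  - move=> i; have [X [-> elX _ _]] := decideP tie_total tie_trans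
      (fun d => powR_ge0 x d) (demand_pos bad_valid) (value_pos bad_valid)
      cap_bad st t.
    case: ifP => // /elX /and3P[_ + iN].
    (* Every job outside the last stage has to start at its release, hence before [K]. *)
    have nJ : ~~ lng J i by move: iN; rewrite cE le_t andbT.
    rewrite /fraction sE (negbTE nJ) subr0 mul1r => le_d; exfalso.
    have K_t : K%:R <= t by rewrite -tauSm -eJ.
    have /andP[_ rK] := release_bad i.
    move: nJ le_d rK; rewrite tnth_bad.
    case: (enum_val i) => [[[j c]|j]|[j c]] /=.
    + rewrite eJ => /negbTE -> le_d rK; move: (tau j) le_d rK => a; lra.
    + by move=> _; move: (tau j) => a; lra.
    + by move=> _; move: (j%:R : R) => a; lra.
have t_tau : t <= tau J.+1.
  have [i lJ] := long_copy ltJ.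
  apply: (next_critical_min nE).
  have := @release_critical _ _ theta st i.
  rewrite tnth_bad; have [-> _ _ _ _] := longP lJ; apply.
  exact: lt_now.
have lt_tk : t < tau J + kappa%:R by move: t_tau; rewrite tauS; lra.
move: t_tau; rewrite le_eqVlt => /orP[/eqP tE|lt_t]; last exact: same.
have st_J : in_stage J.+1 t.
  split; rewrite ?tE // ?tau_lt //.
  apply: (@le_lt_trans _ _ (tau m)); first by rewrite tau_le.
  by rewrite -tauSm; lra.
constructor 2; exists J.+1 => //.
apply: stage_decide (c0 lt_tk) _ _ => //.
- move=> i; case: (prev i) => [?|[lJ ?]]; [constructor 1|constructor 3] => //.
  by exists J.
- by move=> i _; rewrite tE ltxx.
Qed.

Lemma trace_step st : trace_inv st -> trace_inv (gstep f tie C theta st).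
Proof.
move=> inv; rewrite /gstep.
case E: (next_critical theta st) => [t|] //.
have [lt_t crit] := next_criticalP E.
case: inv E lt_t crit => [->|[J sJ stJ]|[K_now FE sN]] E lt_t crit.
- have t0 : t = 0.
    have [i l0] := long_copy (leq0n m).
    apply/le_anti/andP; split.
      have := @release_critical _ _ theta (init_state R #|label|) i.
      rewrite tnth_bad; have [-> _ _ _ _] := longP l0.
      rewrite /tau mul0r => h; apply: (next_critical_min E); apply: h.
      by rewrite /= ltrN10.
    case: crit => [[j <-]|[j [s [//]]]].
    by have /andP[] := release_bad j.
  have tau0 : tau 0 = 0 by rewrite /tau mul0r.
  have s0 : in_stage 0 t.
    split; rewrite ?t0 ?tau0 //.
      by move=> _; rewrite tauS tau0 add0r invr_gt0.
    by rewrite ltr0n addn_gt0 kappa_gt0 orbT.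
  constructor 2; exists 0%N => //.
  apply: stage_decide => //.
  + by apply/setP => i; rewrite !inE.
  + by move=> i; constructor 1.
  + by move=> i _; rewrite t0 tau0 ltxx.
- exact: stage_next stJ E.
- case: crit => [[j tE]|[j [s []]]]; last by rewrite sN.
  have /andP[_] := release_bad j; rewrite tE => t_K.
  by have := lt_trans t_K (le_lt_trans K_now lt_t); rewrite ltxx.
Qed.

Lemma sum_long_value : \sum_(l | long m l) value (label_job l) =
  M%:R * ((1 + m.*2.+2%:R * eta) * Y N%:R).
Proof.
have -> : M%:R = \sum_(l | long m l) (demand (label_job l))%:R :> R.
  by rewrite -natr_sum sum_long.
rewrite mulr_suml; apply: eq_bigr => l /longP.
by case=> _ _ -> -> _; rewrite mul1r tau_m.
Qed.

(** Along the trace the finished set is empty or consists of the last long jobs; an upper bound does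
    not require deciding which occurs at the end. *)
Lemma greedy_bad_le : greedy_welfare f tie C theta <=
  M%:R * ((1 + m.*2.+2%:R * eta) * Y N%:R).
Proof.
have inv : trace_inv (final_state f tie C theta).
  by rewrite /final_state; elim: (_ + _)%N => [|k IH];
     [constructor 1|apply: trace_step].
rewrite /greedy_welfare.
set F := finished _.
have FE : F = finset.set0 \/ F = [set i | lng m i]%SET.
  by rewrite /F; case: inv => [->|[J _ [-> _]]|[_ -> _]]; [left|left|right].
have w0 : 0 <= (1 + m.*2.+2%:R * eta) * Y N%:R.
  by rewrite mulr_ge0 ?(ltW (Y_gt0 _)) // addr_ge0 // mulr_ge0 // ltW.
case: FE => ->; first by rewrite finset.big_set0 mulr_ge0.
rewrite (eq_bigl (fun i => lng m i)); last by move=> i; rewrite inE.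
under eq_bigr do rewrite tnth_bad.
rewrite (big_label _ (long m) (fun l => value (label_job l))).
by rewrite sum_long_value.
Qed.

(** Short jobs, [H] at a time, fill consecutive unit slots ending at [K + 1 - eps]; the last long
    jobs follow at [K + 1]. *)
Definition bad_schedule : allocation R #|label| := fun i t =>
  match enum_val i with
  | inl (inl (j, _)) =>
      if (j == m :> nat) && (K%:R + 1 <= t < K%:R + 1 + kappa%:R) then 1%N
      else 0%N
  | inl (inr j) => 0%N
  | inr (i, _) =>
      if i%:R + 1 - eps <= t < i%:R + 1 - eps + 1 then n else 0%N
  end.

Lemma bad_schedule_feasible : feasible C bad_schedule.
Proof.
move=> t t0.
pose F (l : label) := match l with
  | inl (inl (j, _)) =>
      if (j == m :> nat) && (K%:R + 1 <= t < K%:R + 1 + kappa%:R) then 1%N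
      else 0%N
  | inl (inr j) => 0%N
  | inr (i, _) =>
      if i%:R + 1 - eps <= t < i%:R + 1 - eps + 1 then n else 0%N
  end.
rewrite -[leqLHS]/(\sum_(i < #|label|) F (enum_val i))%N.
rewrite (big_label _ xpredT F).
have M_le : (M <= C)%N by rewrite ltn_subLR //; lia.
have [t_ge|t_lt] := leP (K%:R + 1) t.
  apply: leq_trans M_le; rewrite -(sum_long (leqnn m)) [leqRHS]big_mkcond /=.
  apply: leq_sum => -[[[j c]|j]|[i c]] _ //=.
    by case: eqP => //= _; case: ifP.
  case: ifP => // /andP[_ t_i]; have : (i.+1 <= K)%N by [].
  by rewrite -(ler_nat R) -natr1; case/andP: eps01; lra.
rewrite big_sumType /= [X in (X + _)%N]big1 ?add0n; last first.
  move=> [[j c]|j] _ //=; case: ifP => // /andP[_ /andP[]].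
  by rewrite leNgt t_lt.
pose P (i : 'I_K) := i%:R + 1 - eps <= t < i%:R + 1 - eps + 1.
rewrite (eq_bigr
    (fun p => (fun i (c : 'I_H) => if P i then n else 0%N) p.1 p.2));
  last by case.
rewrite -(pair_bigA _ (fun i (c : 'I_H) => if P i then n else 0%N)) /=.
under eq_bigr do rewrite sum_nat_const card_ord.
(* At most one unit slot contains [t], and its [H] jobs use [H * n] instances. *)
case: (pickP P) => [i0 Pi0|P0]; last first.
  by rewrite big1 // => i _; rewrite P0 muln0.
rewrite (bigD1 i0) //= Pi0 big1 ?addn0 // => i ne.
case: ifP => [Pi|]; last by rewrite muln0.
case/eqP: ne; apply/val_inj => /=; move: Pi Pi0 => /andP[a b] /andP[c d].
have ab : i%:R < i0%:R + 1 :> R by lra.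
have ba : i0%:R < i%:R + 1 :> R by lra.
move: ab ba; rewrite !natr1 !ltr_nat !ltnS => ij ji.
by apply/anti_leq; rewrite ij ji.
Qed.

Lemma OPT_bad_ge :
  M%:R * ((1 + m.*2.+2%:R * eta) * Y N%:R) +
    C%:R * \sum_(i < K) Y (i%:R + 1 - eps) <= OPT C theta.
Proof.
have v0 i : 0 <= value (tnth theta i) by apply/ltW/(value_pos bad_valid).
apply: le_trans (welfare_le_OPT v0 bad_schedule_feasible).
pose short (l : label) := if l is inr _ then true else false.
pose P l := long m l || short l.
have comp i : P (enum_val i) -> completed theta bad_schedule i.
  rewrite /completed tnth_bad /bad_schedule.
  case E: (enum_val i) => [[[j c]|j]|[j c]] //=.
    rewrite /P /= orbF => /eqP jm; exists (K%:R + 1); rewrite jm eqxx.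
    split=> //; last by move=> t ->.
    apply: (@le_trans _ _ K%:R); last by rewrite lerDl.
    by rewrite tau_m ler_nat leq_addr.
  by move=> _; exists (j%:R + 1 - eps); split=> // t ->.
rewrite /welfare [leRHS](bigID (fun i => P (enum_val i))) /=.
apply: ler_wpDr; first exact: sumr_ge0.
rewrite [leRHS](eq_bigl (fun i => P (enum_val i))); last first.
  by move=> i; apply: andb_idl => /comp ci; apply/asboolP.
under [leRHS]eq_bigr do rewrite tnth_bad.
rewrite (big_label _ P (fun l => value (label_job l))) (bigID (long m)) /=.
apply: lerD.
  rewrite (eq_bigl (long m)) ?sum_long_value // => l.
  by rewrite /P; case: (long m l) => //; rewrite andbF.
rewrite (eq_bigl short); last first.
  by move=> l; rewrite /P; case: l => [[[j c]|]|] //=; rewrite ?orbF ?andbN.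
rewrite big_sumType /= [X in X + _]big_pred0 // add0r.
rewrite (eq_bigr (fun p : 'I_K * 'I_H => n%:R * Y (p.1%:R + 1 - eps)));
  last by case.
rewrite -(pair_bigA _
  (fun (i : 'I_K) (c : 'I_H) => n%:R * Y (i%:R + 1 - eps))) /=.
rewrite mulr_sumr le_eqVlt; apply/orP; left; apply/eqP; apply: eq_bigr => i _.
by rewrite sumr_const card_ord natrM -mulrA mulr_natl.
Qed.

End Instance.

(** * Competitive ratios *)

Lemma bernoulli_ineq (R : realDomainType) (r : R) (m : nat) :
  0 <= r -> 1 + m%:R * (r - 1) <= r ^+ m.
Proof.
move=> r0; elim: m => [|m IH]; first by rewrite mul0r addr0.
rewrite exprSr; apply: le_trans (ler_wpM2r r0 IH).
have := mulr_ge0 (ler0n R m) (sqr_ge0 (r - 1)); rewrite -natr1 expr2; nra.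
Qed.

(* Bernoulli's inequality for [r ^+ m.+1], where [y = (m + 1) / m * r]. *)
Lemma expr_div_min (R : realFieldType) (m : nat) (y : R) :
  (0 < m)%N -> 1 < y ->
  (m%:R + 1) * (1 + m%:R^-1) ^+ m <= y ^+ m * (y / (y - 1)).
Proof.
move=> m0 y1; have m0' : m%:R != 0 :> R by rewrite pnatr_eq0 -lt0n.
have mp : 0 < m%:R :> R by rewrite ltr0n.
set q : R := 1 + m%:R^-1; have q0 : 0 < q by rewrite addr_gt0 // invr_gt0.
rewrite mulrA -exprSr ler_pdivlMr ?subr_gt0 //.
have r0 : 0 <= y / q by rewrite divr_ge0 // ltW // (lt_trans _ y1).
have := bernoulli_ineq m.+1 r0.
rewrite expr_div_n ler_pdivlMr ?exprn_gt0 //; apply: le_trans.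
rewrite le_eqVlt; apply/orP; left; apply/eqP.
rewrite exprS -natr1; move: (q ^+ m) => Q; rewrite /q; field.
by rewrite m0' /= gt_eqF // addr_gt0.
Qed.

Section Ratio.
Context (R : realType) (kappa : nat) (kappa_gt0 : (0 < kappa)%N).
Context (tie : rel (candidate R)).
Context (tie_total : total tie) (tie_trans : transitive tie).

Local Notation mech x := (greedy_welfare (fun delta : R => x `^ delta) tie).

(** The factor [chi * y / (y - 1)] of the overview. *)
Definition base_ratio (x : R) : R :=
  x * (growth x kappa 1 / (growth x kappa 1 - 1)).

Lemma base_ratio_ge0 x : 1 < x -> 0 <= base_ratio x.
Proof.
move=> x1; rewrite mulr_ge0 ?divr_ge0 ?(ltW (lt_trans ltr01 x1)) //.
  exact/ltW/growth_gt0.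
by rewrite subr_ge0 ltW // growth_gt1.
Qed.

Lemma base_ratioE x : 1 < x ->
  base_ratio x =
  growth x kappa 1 ^+ kappa * (growth x kappa 1 / (growth x kappa 1 - 1)).
Proof. by move=> x1; rewrite -growthn // growth_kappa. Qed.

Lemma competitive_upper (K : instance_class R) (x r : R) : 1 < x ->
  (forall C n (theta : n.-tuple (job R)), K C n theta ->
    [/\ forall i, valid_job kappa (tnth theta i), (2 * nmax theta <= C.+1)%N
      & C%:R / (C.+1 - nmax theta)%:R <= r]) ->
  competitive K (mech x) (r * base_ratio x + 1).
Proof.
move=> x1 hK [C [n [theta [/hK[valid hcap le_r]]]]]; apply/negP; rewrite -leNgt.
apply: le_trans
  (greedy_upper_bound x1 kappa_gt0 tie_total tie_trans valid hcap) _.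
rewrite ler_wpM2r ?lerD2r ?ler_wpM2r ?base_ratio_ge0 //.
by apply: sumr_ge0 => i _; case: (valid i) => _ _ _ /ltW.
Qed.

(** Combines [greedy_bad_le] with [OPT_bad_ge]. The term in [N] is the truncation of the geometric
    series, and [(1 + d) * growth x kappa eps] the loss from strict interruptions and from [eps]. *)
Lemma instance_bound (c x : R) (K : instance_class R) (N H n : nat)
    (eps d : R) :
  1 < x -> (0 < H)%N -> (0 < n)%N -> (2 * n <= (H * n).+1)%N ->
  0 < eps < 1 -> 0 < d ->
  (forall m (theta : m.-tuple (job R)),
    (forall i, valid_job kappa (tnth theta i)) -> nmax theta = n ->
    K (H * n)%N m theta) ->
  competitive K (mech x) c ->
  (H * n)%:R / (H * n - n).+1%:R * (growth x kappa 1 / (growth x kappa 1 - 1) *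
    (x - (growth x kappa 1)^-1 ^+ N)) <=
  (c - 1) * ((1 + d) * growth x kappa eps).
Proof.
move=> x1 H0 n0 hcap eps01 d0 inK comp.
set Y := growth x kappa; set y := Y 1.
have y1 : 1 < y by apply: growth_gt1.
have y0 : 0 < y by exact: lt_trans ltr01 y1.
(* Makes the largest weight, that of the last long jobs, equal to [1 + d]. *)
pose eta := d / (N.*2).*2.+2%:R.
have eta0 : 0 < eta by rewrite divr_gt0.
set th := bad_instance x kappa N H n eps eta.
have thK : K (H * n)%N _ th.
  by apply: inK; [exact: bad_valid|exact: nmax_bad].
have le_OPT : OPT (H * n) th <= c * mech x (H * n)%N th.
  by rewrite leNgt; apply/negP => lt_O; apply: comp; exists (H * n)%N, _, th.
have W_le :=
  greedy_bad_le x1 kappa_gt0 tie_total tie_trans N H0 n0 hcap eps01 eta0.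
have O_ge := OPT_bad_ge x1 kappa_gt0 N H0 n0 hcap eps01 eta0.
rewrite -/th in W_le O_ge; set W := mech x _ _ in le_OPT W_le.
set M := (H * n - n).+1 in W_le O_ge *.
have wE : 1 + (N.*2).*2.+2%:R * eta = 1 + d by rewrite mulrC divfK // pnatr_eq0.
rewrite wE in W_le O_ge.
have M0 : 0 < M%:R :> R by rewrite ltr0n.
have C0 : 0 < (H * n)%:R :> R by rewrite ltr0n muln_gt0 H0.
set B := M%:R * _ in W_le O_ge.
have B0 : 0 < B by rewrite !mulr_gt0 ?growth_gt0 // addr_gt0.
set S := \sum_(i < _) _ in O_ge.
(* A geometric sum of [N + kappa] terms, with [y ^+ kappa = x]. *)
have SE : S = y / Y eps * ((x * y ^+ N - 1) / (y - 1)).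
  rewrite /S (eq_bigr (fun i : 'I_(N + kappa) => y / Y eps * y ^+ i));
    last first.
    by move=> i _; rewrite -addrA !growthD // growthn // growthN // mulrC.
  rewrite -mulr_sumr; congr (_ * _).
  rewrite -(growth_kappa x1 kappa_gt0) growthn // -exprD addnC subrX1.
  rewrite mulrC mulKf //.
  by rewrite subr_eq0 gt_eqF.
have xN1 : 1 <= x * y ^+ N.
  by rewrite -[1]mulr1 ler_pM // ?(ltW x1) // exprn_ege1 // ltW.
have S0 : 0 <= S.
  rewrite SE mulr_ge0 ?divr_ge0 ?subr_ge0 ?(ltW y1) //; first exact: ltW.
  exact/ltW/growth_gt0.
have W0 : 0 <= W.
  apply: sumr_ge0 => i _; suff [_ _ _ /ltW] : valid_job kappa (tnth th i) by [].
  exact: bad_valid.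
have cW0 : 0 < c * W.
  apply: lt_le_trans le_OPT; apply: lt_le_trans O_ge.
  by rewrite ltr_pwDl // mulr_ge0.
have c0 : 0 < c.
  rewrite ltNge; apply/negP => c0; move: cW0; rewrite ltNge => /negP; apply.
  by rewrite mulr_le0_ge0.
have key : (H * n)%:R * S <= (c - 1) * B.
  by have := ler_wpM2l (ltW c0) W_le; lra.
have yN0 : 0 < y ^+ N by rewrite exprn_gt0.
have E0 : 0 < Y eps by apply: growth_gt0.
rewrite -(ler_pM2r (_ : 0 < M%:R * y ^+ N / Y eps)); last first.
  by rewrite divr_gt0 // mulr_gt0.
apply: le_trans (_ : _ <= (H * n)%:R * S) _.
  rewrite le_eqVlt; apply/orP; left; apply/eqP; rewrite SE exprVn.
  move: (y ^+ N) yN0 (Y eps) E0 => P P0 E E0; field.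
  by rewrite subr_eq0 !gt_eqF.
apply: le_trans key _.
rewrite le_eqVlt; apply/orP; left; apply/eqP; rewrite /B growthn //.
rewrite -/Y -/y; move: (y ^+ N) (Y eps) E0 => P E E0; field.
by rewrite gt_eqF.
Qed.

(** The limit of [instance_bound] with [N = k] and [eps = d = 1 / (k + 2)]. The demand [n k] may
    vary because the capacity factor may reach [r] only in the limit. *)
Lemma competitive_lower (c x r : R) (K : instance_class R) (H : nat)
    (n : nat -> nat) :
  1 < x -> (0 < H)%N -> (forall k, 0 < n k)%N ->
  (forall k, 2 * n k <= (H * n k).+1)%N ->
  ((fun k => (H * n k)%:R / (H * n k - n k).+1%:R) @ \oo --> r)%classic ->
  (forall k m (theta : m.-tuple (job R)),
    (forall i, valid_job kappa (tnth theta i)) -> nmax theta = n k ->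
    K (H * n k)%N m theta) ->
  competitive K (mech x) c ->
  r * base_ratio x + 1 <= c.
Proof.
move=> x1 H0 n0 hcap cvr inK comp.
have y1 := growth_gt1 x1 kappa_gt0; set y := growth x kappa 1 in y1 *.
have y0 : 0 < y by exact: lt_trans ltr01 y1.
rewrite -lerBrDr.
have d01 k : 0 < (k.+2%:R^-1 : R) < 1.
  by rewrite invr_gt0 ltr0n invf_lt1 ?ltr0n // ltr1n.
have cvd : ((fun k => k.+2%:R^-1 : R) @ \oo --> (0 : R))%classic.
  by have := @cvg_harmonic R; rewrite -cvg_shiftS.
have cvY : ((fun k => growth x kappa k.+2%:R^-1) @ \oo --> (1 : R))%classic.
  have -> : (fun k => growth x kappa k.+2%:R^-1) =
      (fun k => expR (k.+2%:R^-1 * (ln x / kappa%:R))).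
    apply/funext => k; rewrite /growth /powR gt_eqF ?(lt_trans ltr01 x1) //.
    by congr expR; ring.
  suff : ((fun k => expR (k.+2%:R^-1 * (ln x / kappa%:R))) @ \oo
      --> expR 0)%classic by rewrite expR0.
  apply: continuous_cvg; first exact: continuous_expR.
  have := cvgM cvd (cvg_cst (ln x / kappa%:R)).
  by rewrite mul0r => h; exact: h.
have cvN : ((fun N => y^-1 ^+ N) @ \oo --> (0 : R))%classic.
  by apply: cvg_expr; rewrite ger0_norm ?invr_ge0 ?(ltW y0) // invf_lt1.
have -> : r * base_ratio x = r * (y / (y - 1) * (x - 0)).
  by rewrite subr0 /base_ratio -/y; ring.
have -> : c - 1 = (c - 1) * ((1 + 0) * 1) by rewrite addr0 !mulr1.
apply: (ler_cvg_to
  (cvgM cvr (cvgM (cvg_cst (y / (y - 1))) (cvgB (cvg_cst x) cvN)))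
  (cvgM (cvg_cst (c - 1)) (cvgM (cvgD (cvg_cst (1 : R)) cvd) cvY))). 
apply: nearW => k; have /andP[d0 _] := d01 k.
exact: (instance_bound k x1 H0 (n0 k) (hcap k) (d01 k) d0 (inK k) comp).
Qed.

Lemma competitive_ratio_eq (K : instance_class R) (W : mech_welfare R) (c : R) :
  competitive K W c -> (forall c', competitive K W c' -> c <= c') ->
  competitive_ratio K W = c%:E.
Proof.
move=> cP c_min; apply/le_anti/andP; split.
  by apply: ereal_inf_lbound; exists c.
by apply: le_ereal_inf_tmp => _ [c' c'P <-]; rewrite lee_fin; apply: c_min.
Qed.

Lemma competitive_ratio_ge (K : instance_class R) (W : mech_welfare R) (c : R) :
  (forall c', competitive K W c' -> c <= c') ->
  (c%:E <= competitive_ratio K W)%E.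
Proof.
move=> c_min.
by apply: le_ereal_inf_tmp => _ [c' c'P <-]; rewrite lee_fin; apply: c_min.
Qed.

End Ratio.

(** Here [y] is [q = (kappa + 1) / kappa], and [q / (q - 1) = kappa + 1]. *)
Lemma ratio_at_chi (R : realType) (kappa : nat) : (0 < kappa)%N ->
  let chi : R := ((kappa%:R + 1) / kappa%:R) ^+ kappa in
  1 < chi /\
  base_ratio kappa chi = (kappa%:R + 1) * (1 + kappa%:R^-1) ^+ kappa.
Proof.
move=> k0; have kp : 0 < kappa%:R :> R by rewrite ltr0n.
have qE : (kappa%:R + 1) / kappa%:R = 1 + kappa%:R^-1 :> R.
  by field; rewrite gt_eqF.
rewrite qE; set q : R := 1 + _; have q1 : 1 < q by rewrite ltrDl invr_gt0.
have q0 : 0 < q by apply: lt_trans q1.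
have chi1 : 1 < q ^+ kappa by rewrite exprn_egt1 // -lt0n.
split=> //; rewrite /base_ratio.
have -> : growth (q ^+ kappa) kappa 1 = q.
  rewrite /growth -powR_mulrn ?(ltW q0) // -powRrM mul1r divff ?gt_eqF //.
  by rewrite powRr1 // ltW.
rewrite mulrC; congr (_ * _).
have -> : q - 1 = kappa%:R^-1 by rewrite /q addrC addKr.
by rewrite invrK mulrDl mul1r mulVf ?gt_eqF.
Qed.

(** The inequality [C / (C + 1 - m) <= (h + 1) / h] cleared of denominators. *)
Lemma capacity_bound (h C m : nat) : (h.+1 * m <= C)%N ->
  (C * h <= h.+1 * (C.+1 - m))%N.
Proof.
move=> le_C; rewrite mulnBr; apply: leq_trans (leq_sub2l _ le_C).
by rewrite [(C * h)%N]mulnC mulSn mulnS; lia.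
Qed.

Theorem proposition3p7 (R : realType) (kappa : nat) (hkappa : (1 <= kappa)%N)
    (tie : rel (candidate R)) (tie_total : total tie)
    (tie_trans : transitive tie) :
  let chi : R := ((kappa%:R + 1) / kappa%:R) ^+ kappa in
  let ratio (K : instance_class R) (x : R) : \bar R :=
    competitive_ratio K (greedy_welfare (fun delta => x `^ delta) tie) in
  [/\ 1 < chi,
      forall h : nat, (2 <= h)%N ->
        ratio (capacity_class kappa h) chi =
          (h%:R / (h%:R - 1) * ((kappa%:R + 1) * (1 + kappa%:R^-1) ^+ kappa)
           + 1)%:E /\
        (forall x : R, 1 < x ->
          (ratio (capacity_class kappa h) chi
             <= ratio (capacity_class kappa h) x)%E)
    & ratio (unit_class kappa) chi =
        ((kappa%:R + 1) * (1 + kappa%:R^-1) ^+ kappa + 1)%:E /\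
      (forall x : R, 1 < x ->
        (ratio (unit_class kappa) chi <= ratio (unit_class kappa) x)%E)].
Proof.
move=> chi ratio.
have [chi1 baseE] := @ratio_at_chi R kappa hkappa; rewrite -/chi in chi1 baseE.
have base_min x : 1 < x -> base_ratio kappa chi <= base_ratio kappa x.
  move=> x1; rewrite baseE base_ratioE //.
  exact: expr_div_min (growth_gt1 x1 hkappa).
(* Both classes follow this scheme and differ only in [r], the supremum of [C / (C - nmax + 1)]. *)
have optimal K r : 0 <= r ->
    (forall C n (theta : n.-tuple (job R)), K C n theta ->
      [/\ forall i, valid_job kappa (tnth theta i), (2 * nmax theta <= C.+1)%N
        & C%:R / (C.+1 - nmax theta)%:R <= r]) ->
    (forall x c, 1 < x ->
      competitive K (greedy_welfare (fun delta => x `^ delta) tie) c ->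
      r * base_ratio kappa x + 1 <= c) ->
    ratio K chi =
      (r * ((kappa%:R + 1) * (1 + kappa%:R^-1) ^+ kappa) + 1)%:E /\
    (forall x : R, 1 < x -> (ratio K chi <= ratio K x)%E).
  move=> r0 upper lower.
  have ratioE : ratio K chi =
      (r * ((kappa%:R + 1) * (1 + kappa%:R^-1) ^+ kappa) + 1)%:E.
    rewrite -baseE; apply: competitive_ratio_eq.
      exact: competitive_upper.
    by move=> c; apply: lower.
  split; first exact: ratioE.
  move=> x x1; rewrite ratioE; apply: competitive_ratio_ge => c comp.
  apply: le_trans (lower _ _ x1 comp).
  by rewrite lerD2r ler_wpM2l // -baseE base_min.
split; first exact: chi1.
- move=> h0 h2.
  have [h h0E h1] : exists2 h, h0 = h.+1 & (0 < h)%N.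
    by case: h0 h2 => // h h1; exists h.
  rewrite h0E; have -> : h.+1%:R - 1 = h%:R :> R by rewrite -natr1 addrK.
  have hp : 0 < h%:R :> R by rewrite ltr0n.
  apply: optimal; first by rewrite divr_ge0.
  + move=> C n theta [valid le_C]; split=> //.
      by rewrite ltnW // ltnS (leq_trans _ le_C) // leq_mul2r ltnS h1 orbT.
    have le_nmax : (nmax theta <= C)%N.
      by apply: leq_trans le_C; rewrite leq_pmull.
    rewrite ler_pdivrMr ?ltr0n ?subn_gt0 // mulrAC ler_pdivlMr // -!natrM.
    by rewrite ler_nat capacity_bound.
  (* With capacity [(h + 1) n] the factor is [(h + 1) n / (h n + 1)], which tends to [(h + 1) / h]
     as [n = k + 1] grows. *)
  + move=> x c x1; apply: (competitive_lower hkappa tie_total tie_trans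
      (H := h.+1) (n := succn)) => //.
    * by move=> k; rewrite ltnW // ltnS leq_mul2r ltnS h1 orbT.
    * have -> : (fun k => (h.+1 * k.+1)%:R / (h.+1 * k.+1 - k.+1).+1%:R : R) =
          (fun k => h.+1%:R / (h%:R + harmonic k)).
        apply/funext => k /=.
        have -> : (h.+1 * k.+1 - k.+1 = h * k.+1)%N by rewrite mulSn addKn.
        rewrite -(natr1 (h * k.+1)) !natrM.
        have : 0 < k.+1%:R :> R by rewrite ltr0n.
        move: (h.+1%:R : R) (k.+1%:R : R) => H K K0.
        have HK : h%:R * K + 1 != 0 by rewrite gt_eqF // addr_gt0 // mulr_gt0.
        have -> : h%:R + K^-1 = (h%:R * K + 1) / K by field; rewrite gt_eqF.
        by rewrite invf_div mulrA.
      have := cvgM (cvg_cst (h.+1%:R : R))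
        (cvgV (_ : h%:R + 0 != 0 :> R)
          (cvgD (cvg_cst (h%:R : R)) (@cvg_harmonic R))).
      by rewrite addr0 gt_eqF // => cv; apply: cv.
    * by move=> k m theta valid nE; split; rewrite ?nE.
- rewrite -[X in _ = (X + _)%:E]mul1r; apply: optimal => //.
  + by move=> C n theta [valid [-> ->]]; split=> //; rewrite divff.
  (* With a single instance and unit demand the factor is exactly [1]. *)
  + move=> x c x1; apply: (competitive_lower hkappa tie_total tie_trans
      (H := 1%N) (n := fun=> 1%N)) => //.
    by rewrite mul1n subnn divff //; exact: cvg_cst.
Qed.
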